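(* Let $p$ be a prime, let $\eta\in(0,1)$, and let $A\subseteq \mathbb{Z}/p\mathbb{Z}$ be a set with $|A|\geq \eta p>0$ and $|2A|=2|A|+r<p$. Let $$\alpha=-\tfrac54+\tfrac14\sqrt{9+8\,\eta\, p\sin(\pi/p)/\sin(\pi\eta/3)}.$$ Suppose that $$|2A|\leq (2+\alpha)|A|-3\qquad\text{and}\qquad |A|\leq \frac{p-r}{3}.$$ Then there exist arithmetic progressions $P_A,P_{2A}\subseteq \mathbb{Z}/p\mathbb{Z}$ with the same common difference such that $A\subseteq P_A$, $|P_A|\leq |A|+r+1$, $P_{2A}\subseteq 2A$, and $|P_{2A}|\geq 2|A|-1$.
   Context: For $A\subseteq \mathbb{Z}/p\mathbb{Z}$, $2A=A+A=\{x+y: x,y\in A\}$. An arithmetic progression in $\mathbb{Z}/p\mathbb{Z}$ with difference $g\neq 0$ is a set of the form $\{a, a+g, a+2g,\dots,a+(k-1)g\}$ with $1\le k\le p$. *)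

(* Defs.v *)
From Stdlib Require Import Reals ZArith.
From HB Require Import structures.
From mathcomp Require Import all_boot all_order all_algebra.

Set Implicit Arguments.
Unset Strict Implicit.
Unset Printing Implicit Defensive.

(* A + B = {x + y : x in A, y in B} in Z/pZ (p prime, so 'Z_p is Z/pZ). *)
Definition sumset (p : nat) (A B : {set 'Z_p}) : {set 'Z_p} :=
  [set (x + y)%R | x in A, y in B].

Definition is_AP (p : nat) (g : 'Z_p) (P : {set 'Z_p}) : Prop :=
  g != 0%R /\
  exists (a : 'Z_p) (k : nat), (1 <= k <= p)%N /\
    P = [set (a + g *+ (val i))%R | i : 'I_k].

Definition alpha (eta : R) (p : nat) : R :=
  Rplus (Ropp (Rdiv 5 4))
    (Rmult (Rdiv 1 4)
       (sqrt (Rplus 9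
          (Rdiv (Rmult (Rmult (Rmult 8 eta) (INR p)) (sin (Rdiv PI (INR p))))
                (sin (Rdiv (Rmult PI eta) 3)))))).

(* Main.v *)
(* Write S = 2A.  If every nonzero Fourier coefficient of 1_A were at most K in
   absolute value, counting the solutions of a + b = s with s in S would give
   |A|^2 <= K |S|.  Conversely, if after every dilation each half-circle of
   residues contained at most (|S| + 3)/3 points of A, all coefficients would be
   at most sin(pi D/p)/sin(pi/p) with D <= (1 + 2 alpha)|A|/3, because A consists
   of distinct p-th roots of unity; the definition of alpha makes these two bounds
   incompatible.  Hence some subset A' of A with 3|A'| - 4 >= |2A| lies in a
   progression short enough for sums of two elements to behave as in the integers.
   Freiman's 3k - 4 theorem and its complement on long progressions then show that
   2A' contains a progression of length 2|A'| - 1, so the complement T of 2A lies in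
   a progression of length p - 2|A'| + 1 with the same difference.  Therefore
   T - A' is also a sum of two sets of integers; it is disjoint from A and contains
   a long progression, which confines A itself to a short progression.  Now the
   integer theorems apply to A. *)
Require Import Defs.
From Stdlib Require Import Reals ZArith.
From HB Require Import structures.
From mathcomp Require Import all_boot all_order all_algebra.
From mathcomp Require Import finmap zify ring lra reals Rstruct archimedean.

Set Implicit Arguments.
Unset Strict Implicit.
Unset Printing Implicit Defensive.

Import Order.TTheory GRing.Theory Num.Theory.
Local Open Scope fset_scope.
Local Open Scope ring_scope.

(** * Sumsets of finite sets of integers *)

(** Since r = |2A| - 2|A|, the condition |A| <= (p - r)/3 says |2A| + |A| <= p. It acts twice: it
    makes the energy |A|(p - |A|) at most |2A|(p - |2A|), so that a factor p - |2A| cancels in the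
    Fourier count, and it gives the complement of 2A at least |A| elements, enough to treat T - A'
    by the integer theorem. The obstacle is to pass from half-circles to coefficients: a bound on
    two half-circles only controls, for each level c, how many more points have cosine above c than
    below -c. So the cosine is clipped at cos(pi D/p); the clipped part is summed level by level,
    and the excess lives on at most D positions. The constant comes from the extreme case |A| = eta
    p and D = (1 + 2 alpha)|A|/3, where the angle pi D/p is (1 + 2 alpha) pi eta/3. Concavity of the
    sine takes out the factor 1 + 2 alpha, and alpha is the root that turns the result into K (2 +
    alpha) <= |A|. The term -3 in the bound on |2A| then makes the contradiction strict. *)

Definition fsum (A B : {fset int}) : {fset int} :=
  [fset (a + b)%R | a in A, b in B].

Definition zitv (a : int) (n : nat) : {fset int} :=
  [fset (a + (i : nat)%:Z)%R | i in iota 0 n].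

Definition seg (A : {fset int}) (a b : int) : {fset int} :=
  [fset x : int in A | (a <= x <= b)%R].

Lemma fsumP (A B : {fset int}) (x : int) :
  reflect (exists a b, [/\ a \in A, b \in B & x = a + b]) (x \in fsum A B).
Proof.
apply: (iffP (imfset2P _ _ _ _ _)) => /=.
  by case=> a aA [b bB ->]; exists a, b.
by case=> a [b [aA bB ->]]; exists a => //; exists b.
Qed.

Lemma mem_fsum (A B : {fset int}) (a b : int) :
  a \in A -> b \in B -> a + b \in fsum A B.
Proof. by move=> aA bB; apply/fsumP; exists a, b. Qed.

Lemma fsumC (A B : {fset int}) : fsum A B = fsum B A.
Proof.
by apply/fsetP => x; apply/fsumP/fsumP => -[a [b [? ? ->]]]; exists b, a; rewrite addrC.
Qed.

Lemma fsumS (A B A' B' : {fset int}) :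
  A `<=` A' -> B `<=` B' -> fsum A B `<=` fsum A' B'.
Proof.
move=> /fsubsetP sA /fsubsetP sB; apply/fsubsetP => x /fsumP[a [b [/sA ? /sB ? ->]]].
exact: mem_fsum.
Qed.

Lemma mem_zitv (a : int) (n : nat) (x : int) :
  (x \in zitv a n) = (a <= x < a + n%:Z).
Proof.
apply/imfsetP/idP => /= [[i + ->]|xI]; first by rewrite mem_iota; lia.
by exists `|x - a|%N; [rewrite mem_iota|]; lia.
Qed.

Lemma nat_of_ge0 (x : int) : 0 <= x -> exists n : nat, n%:Z = x.
Proof. by move=> x0; exists (absz x); lia. Qed.

Lemma card_zitv (a : int) (n : nat) : #|` zitv a n| = n.
Proof.
rewrite card_imfset /=; last by move=> i j /addrI [].
by rewrite undup_id ?iota_uniq // size_iota.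
Qed.

Lemma card_fimg (T U : choiceType) (f : T -> U) (A : {fset T}) :
  injective f -> #|` [fset f x | x in A]| = #|` A|.
Proof. by move=> fI; rewrite card_imfset. Qed.

Lemma leq_card_inj (T U : choiceType) (f : T -> U) (A : {fset T}) (B : {fset U}) :
  {in A &, injective f} -> (forall x, x \in A -> f x \in B) ->
  (#|` A| <= #|` B|)%N.
Proof.
move=> fI fAB; rewrite -(card_in_imfset imfset_key fI).
apply: fsubset_leq_card; apply/fsubsetP => y /imfsetP[x /= xA ->]; exact: fAB.
Qed.

Lemma mem_seg (A : {fset int}) (a b x : int) :
  (x \in seg A a b) = (x \in A) && (a <= x <= b).
Proof. by rewrite !inE. Qed.

Lemma segE (A : {fset int}) (a b : int) (n : nat) :
  n%:Z = b - a + 1 -> seg A a b = A `&` zitv a n.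
Proof.
move=> nE; apply/fsetP => x; rewrite mem_seg !inE mem_zitv.
by apply: andb_id2l => _; lia.
Qed.

Lemma leq_card_cover (A I : {fset int}) (a b c d : int) :
  (forall x : int, x \in A -> [|| a <= x <= b, c <= x <= d | x \in I]) ->
  #|` A|%:Z <= #|` seg A a b|%:Z + #|` seg A c d|%:Z + #|` I|%:Z.
Proof.
move=> h; rewrite -!PoszD lez_nat; apply: (@leq_trans #|` (seg A a b `|` seg A c d) `|` I|).
  apply: fsubset_leq_card; apply/fsubsetP => x xA; rewrite !inE /= xA /=.
  by rewrite -orbA h.
have U (X Y : {fset int}) : (#|` X `|` Y| <= #|` X| + #|` Y|)%N by rewrite cardfsU leq_subr.
by apply: leq_trans (U _ _) _; rewrite leq_add2r U.
Qed.

(** The map b -> t - b sends [B] injectively into [I] and, as [t] is no sum, avoids [A]. All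
    counting of holes forced by missing sums rests on this pigeonhole. *)
Lemma reflect_card (A B I : {fset int}) (t : int) :
  (forall b : int, b \in B -> t - b \in I) -> t \notin fsum A B ->
  #|` B|%:Z + #|` A `&` I|%:Z <= #|` I|%:Z.
Proof.
move=> BI tN; rewrite -PoszD lez_nat -(cardfsID A I) fsetIC addnC leq_add2l.
apply: (@leq_card_inj _ _ (fun b => t - b)) => [x y _ _|b bB]; first lia.
rewrite !inE BI // andbT; apply: contra tN => tA.
by apply/fsumP; exists (t - b), b; split => //; lia.
Qed.

(** Counting modulo [L]: a residue t in [J] gives one element of [R], either t or t + L, and a point
    t of [K] gives t + L in addition. Points of [K] may lie outside [J]; in the applications to
    sumsets, L itself is one of them. *)
Lemma card_mod (R J K : {fset int}) (L : int) :
  (forall t : int, t \in J -> 0 <= t < L) ->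
  (forall t : int, t \in J -> (t \in R) || (t + L \in R)) ->
  (forall t : int, t \in K -> [/\ 0 <= t, t + L \in R & (t \in J -> t \in R)]) ->
  (#|` J| + #|` K| <= #|` R|)%N.
Proof.
move=> JL JR KR; pose f (t : int) : int := t + L.
set X := J `&` R; set Y := (J `\` R) `|` K.
have fI : injective f by move=> x y; rewrite /f; lia.
have -> : (#|` J| + #|` K| = #|` X| + #|` [fset f t | t in Y]|)%N.
  rewrite card_fimg // /X /Y -(cardfsID R J) cardfsU -addnA; congr addn.
  suff -> : (J `\` R) `&` K = fset0 by rewrite cardfs0 subn0.
  apply/fsetP => t; rewrite !inE; apply/negP => /andP[/andP[tR tJ] tK].
  by have [_ _ /(_ tJ)] := KR t tK; rewrite (negPf tR).
have -> : (#|` X| + #|` [fset f t | t in Y]| = #|` X `|` [fset f t | t in Y]|)%N.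
  rewrite cardfsU; suff -> : X `&` [fset f t | t in Y] = fset0 by rewrite cardfs0 subn0.
  apply/fsetP => z; rewrite !inE; apply/negP => /andP[/andP[zJ _] /imfsetP[/= t]].
  rewrite !inE /f => tY zE; have := JL z zJ.
  case/orP: tY => [/andP[_ /JL]|/KR[]]; lia.
apply: fsubset_leq_card; apply/fsubsetP => z; rewrite !inE => /orP[/andP[]//|].
case/imfsetP => /= t; rewrite !inE /f => tY ->; case/orP: tY => [/andP[tR tJ]|/KR[]//].
by have := JR t tJ; rewrite (negPf tR).
Qed.

(** * Long intervals in sumsets *)

Lemma seg_sub (A : {fset int}) (a b : int) : seg A a b `<=` A.
Proof. exact: fset_sub. Qed.

Lemma missing_low (A B : {fset int}) (u : int) :
  -1 <= u -> u \notin fsum A B ->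
  #|` seg B 0 u|%:Z + #|` seg A 0 u|%:Z <= u + 1.
Proof.
move=> u1 uN; have [|n nE] := @nat_of_ge0 (u + 1); first lia.
have := @reflect_card A (seg B 0 u) (zitv 0 n) u.
rewrite card_zitv nE -(@segE A 0 u) ?nE; last lia; apply=> [b|].
  by rewrite mem_seg mem_zitv; lia.
by apply: contra uN; apply/fsubsetP/fsumS => //; apply: seg_sub.
Qed.

Lemma missing_high (A B : {fset int}) (L M w : int) :
  w <= M + 1 -> w + L \notin fsum A B ->
  #|` seg B w M|%:Z + #|` seg A (L + w - M) L|%:Z <= M + 1 - w.
Proof.
move=> w1 wN; have [|n nE] := @nat_of_ge0 (M + 1 - w); first lia.
have := @reflect_card A (seg B w M) (zitv (L + w - M) n) (w + L).
rewrite card_zitv nE -(@segE A (L + w - M) L) ?nE; last lia; apply=> [b|].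
  by rewrite mem_seg mem_zitv; lia.
by apply: contra wN; apply/fsubsetP/fsumS => //; apply: seg_sub.
Qed.

Lemma exists_max_int (P : pred int) (a b : int) :
  a <= b -> P a ->
  exists2 u : int, P u & a <= u <= b /\ forall t : int, P t -> t <= b -> t <= u.
Proof.
move=> ab Pa; pose Q (i : nat) := P (b - i%:Z) && (i <= `|b - a|)%N.
have exQ : exists i, Q i by exists (absz (b - a)); rewrite /Q leqnn andbT (_ : b - _ = a) //; lia.
case: (ex_minnP exQ) => m /andP[Pm mb] mmin.
exists (b - m%:Z) => //; split=> [|t Pt tb]; first lia.
case: (lerP a t) => [at_|]; last lia.
have := mmin (absz (b - t)); rewrite /Q (_ : b - (absz (b - t))%:Z = t) ?Pt /=; last lia.
by move=> H; have : (absz (b - t)%R <= absz (b - a)%R)%N by [lia]; move=> /H; lia.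
Qed.

Lemma leq_seg_cover (A : {fset int}) (L u w : int) :
  (forall x : int, x \in A -> 0 <= x <= L) ->
  #|` A|%:Z <= #|` seg A 0 u|%:Z + #|` seg A w L|%:Z + Num.max 0 (w - u - 1).
Proof.
move=> AI; have [n nE] := @nat_of_ge0 (Num.max 0 (w - u - 1)) ltac:(lia).
rewrite -nE -[n in leRHS](card_zitv (u + 1)); apply: leq_card_cover.
by move=> x /AI; rewrite mem_zitv; lia.
Qed.

Definition spans (A : {fset int}) (L : int) : Prop :=
  [/\ 0 \in A, L \in A & forall x : int, x \in A -> 0 <= x <= L].

(** For such t the whole of t - B lies in [0, L], which has too few points to hold it apart from
    [A]. *)
Lemma fsum_middle (A B : {fset int}) (L M t : int) :
  spans A L -> spans B M -> M <= L -> L + 3 <= #|` A|%:Z + #|` B|%:Z ->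
  M <= t <= L -> t \in fsum A B.
Proof.
move=> [_ AL AI] [_ BM BI] ML Lub tI; apply/negPn/negP => tN.
have [n nE] := @nat_of_ge0 (L + 1) ltac:(have := BI _ BM; lia).
have := @reflect_card A B (zitv 0 n) t _ tN.
rewrite card_zitv (_ : A `&` _ = A).
  suff H : forall b : int, b \in B -> t - b \in zitv 0 n by move=> /(_ H); lia.
  by move=> b /BI; rewrite mem_zitv; lia.
by apply/fsetP => x; rewrite !inE mem_zitv; apply: andb_idr => /AI; lia.
Qed.

(** If t < M and t + L were both missing, the two pigeonholes would allow (t + 1) + (M + 1 - t)
    points of [A] and [B] at the two ends, and at most max(0, L - M - 1) further points of [A]: at
    most L + 2 in all. *)
Lemma fsum_residue (A B : {fset int}) (L M t : int) :
  spans A L -> spans B M -> M <= L -> L + 3 <= #|` A|%:Z + #|` B|%:Z ->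
  0 <= t < L -> (t \in fsum A B) || (t + L \in fsum A B).
Proof.
move=> sA sB ML Lub tI; have [_ _ AI] := sA; have [_ _ BI] := sB.
case: (lerP M t) => [Mt|tM]; first by rewrite (fsum_middle sA sB) //; lia.
apply/negPn/negP; rewrite negb_or => /andP[tN tLN].
have := @missing_low A B t ltac:(lia) tN; have := @missing_high A B L M t ltac:(lia) tLN.
by have := leq_seg_cover t (L + t - M) AI; have := leq_seg_cover t t BI; lia.
Qed.

(* Call t < M low-missing if t is not a sum and high-missing if t + L is not.
   Low-missing points force many holes of A and B below them, high-missing ones
   above them.  If some high-missing w precedes a low-missing u, taken with no
   missing point in between, the holes and the doubly covered residues mod L
   make A + B too large; hence all low-missing points come first and the
   sums fill everything from the last of them to the first high-missing one. *)
Lemma long_interval (A B : {fset int}) (L M : int) :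
  spans A L -> spans B M ->
  M <= L -> L + 3 <= #|` A|%:Z + #|` B|%:Z ->
  (#|` fsum A B| + 4 <= #|` A| + 2 * #|` B|)%N ->
  exists c : int, forall t, c <= t < c + #|` A|%:Z + #|` B|%:Z - 1 -> t \in fsum A B.
Proof.
move=> sA sB ML Lub; set R := fsum A B => Rub.
have [A0 AL AI] := sA; have [B0 BM BI] := sB.
have low (u : int) : -1 <= u -> u \notin R -> _ := @missing_low A B u.
have high (w : int) : w <= M + 1 -> w + L \notin R -> _ := @missing_high A B L M w.
have L0 : 0 <= M by have := BI _ B0; lia.
have BR (b : int) : b \in B -> b \in R by move=> bB; rewrite -(add0r b) mem_fsum.
have BRL (b : int) : b \in B -> b + L \in R by move=> bB; rewrite addrC mem_fsum.
have Acov u w := leq_seg_cover u (L + w - M) AI.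
have Bcov u w := leq_seg_cover u w BI.
have cov (t : int) : 0 <= t < L -> (t \in R) || (t + L \in R) := fsum_residue sA sB ML Lub.
have gap (w u : int) : 0 < w -> w <= u -> u < M -> w + L \notin R -> u \notin R -> False.
  move=> + wu; have [n] := @nat_of_ge0 (u - w) ltac:(lia).
  elim/ltn_ind: n w u wu => n IH w u wu nE w0 uM wN uN.
  have gap_free (t : int) : w < t < u -> (t \in R) && (t + L \in R).
    move=> tI; apply/negPn/negP; rewrite negb_and => /orP[tN|tN].
      by apply: (IH (absz (t - w)) _ w t) => //; lia.
    by apply: (IH (absz (u - t)) _ t u) => //; lia.
  have {}wu : w < u.
    rewrite lt_neqAle wu andbT; apply: contraNneq uN => wE.
    by have := cov w ltac:(lia); rewrite (negPf wN) orbF wE.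
  have wB : w \notin B by apply: contra wN => /BRL.
  have uB : u \notin B by apply: contra uN => /BR.
  have [m mE] := @nat_of_ge0 (u - w - 1) ltac:(lia).
  have [l lE] := @nat_of_ge0 L ltac:(lia).
  (* The residues covered twice: b = 0 + b and L + b for b in [B], and every point strictly between
     w and u, where nothing is missing. *)
  have := @card_mod R (zitv 0 l) (B `|` zitv (w + 1) m) L.
  have BU : #|` B|%:Z + #|` B `&` zitv (w + 1) m|%:Z = #|` seg B 0 u|%:Z + #|` seg B w M|%:Z.
    rewrite -!PoszD -(cardfsUI (seg B 0 u)); congr Posz; congr addn; congr (#|` _|); apply/fsetP => x.
      by rewrite in_fsetU !mem_seg; case: (boolP (x \in B)) => [/BI|_]; lia.
    rewrite !in_fsetI mem_zitv !mem_seg; case: (boolP (x \in B)) => //= xB.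
    have : x != w by apply: contraNneq wB => <-.
    have : x != u by apply: contraNneq uB => <-.
    by have := BI _ xB; lia.
  rewrite cardfsU !card_zitv => H.
  have {}H : (l + (#|` B| + m - #|` B `&` zitv (w + 1) m|) <= #|` R|)%N.
    apply: H => t; rewrite ?inE ?mem_zitv; first lia.
      by move=> tI; apply: cov; lia.
    case/orP => [tB|tI]; first by split => [||_]; [have := BI _ tB; lia|exact: BRL|exact: BR].
    by have /andP[] := gap_free t ltac:(lia); split => //; lia.
  have capB : (#|` B `&` zitv (w + 1) m| <= #|` B|)%N by apply/fsubset_leq_card/fsubsetIl.
  have := low u ltac:(lia) uN; have := high w ltac:(lia) wN.
  by have := Acov u w; lia.
(* Defaults when no point is missing: -1 below and, for the negated search of the least high-missing
   point, -M - 1. Both stand for non-sums, and [low] and [high] hold there with empty segments. *)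
pose E0 (t : int) := (t == -1) || ((t < M) && (t \notin R)).
have [||u E0u [uI umax]] := @exists_max_int E0 (-1) (M - 1); rewrite /E0 //; first lia.
pose E1 (t : int) := (t == - M - 1) || ((0 < -t) && (- t + L \notin R)).
have [||w E1w [wI wmax]] := @exists_max_int E1 (-M-1) (-1); rewrite /E1 ?eqxx //; first lia.
have out (t : int) : (t < 0) || (L + M < t) -> t \notin R.
  by move=> tO; apply/fsumP => -[a [b [/AI aI /BI bI tE]]]; lia.
have uN : u \notin R.
  by case/orP: E0u => [/eqP uE|/andP[]//]; apply: out; lia.
have wN : - w + L \notin R.
  by case/orP: E1w => [/eqP uE|/andP[]//]; apply: out; lia.
have uw : u < - w.
  rewrite ltNge; apply/negP => wu; apply: (gap (- w) u) => //; lia.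
have := low u ltac:(lia) uN; have := high (- w) ltac:(lia) wN.
have := Acov u (- w); have := Bcov u (- w) => *.
(* The holes counted below u and above -w leave at least |A| + |B| - 1 integers strictly between u
   and L - w. *)
exists (u + 1) => t tI.
case: (ltrP t M) => [tM|Mt].
  apply/negPn/negP => tN; have := umax t; rewrite /E0 tM tN orbT; lia.
case: (lerP t L) => [tL|Lt]; first by apply: (fsum_middle sA sB); lia.
apply/negPn/negP => tN; have := wmax (L - t); rewrite /E1 opprB subrK tN andbT; lia.
Qed.

(** * Freiman's 3k - 4 theorem *)

Definition coprime_set (A : {fset int}) : Prop :=
  forall d : int, (forall x : int, x \in A -> (d %| x)%Z) -> `|d| = 1.

(** When [A] fills more than half of [0, L], every residue modulo L is a sum, and each a of [A]
    occurs twice, as a + 0 and a + L. *)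
Lemma card_sumset_dense (A : {fset int}) (L : int) :
  spans A L -> L + 3 <= 2 * #|` A|%:Z -> L + #|` A|%:Z <= #|` fsum A A|%:Z.
Proof.
move=> sA Lub; have [A0 AL AI] := sA.
have [l lE] := @nat_of_ge0 L ltac:(have := AI _ A0; lia).
have := @card_mod (fsum A A) (zitv 0 l) A L; rewrite card_zitv => H.
suff : (l + #|` A| <= #|` fsum A A|)%N by lia.
apply: H => t; first by rewrite mem_zitv; lia.
  by rewrite mem_zitv => tI; apply: (fsum_residue sA sA) => //; lia.
move=> tA; split; [have := AI _ tA; lia|exact: mem_fsum|].
by move=> _; rewrite -(addr0 t) mem_fsum.
Qed.

(** The sumset contains [A] and A + L, which meet at most in L. *)
Lemma leq_card_fsum_self (A : {fset int}) (L : int) :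
  spans A L -> (2 * #|` A| <= #|` fsum A A| + 1)%N.
Proof.
move=> [A0 AL AI]; set f := fun x : int => (x + L : int).
have fI : injective f by move=> x y; rewrite /f; lia.
have := cardfsUI A [fset f x | x in A]; rewrite card_fimg // => cU.
have : (#|` A `|` [fset f x | x in A]| <= #|` fsum A A|)%N.
  apply: fsubset_leq_card; apply/fsubsetP => x; rewrite in_fsetU.
  case/orP => [xA|/imfsetP[y /= yA ->]]; last exact: mem_fsum.
  by rewrite -(addr0 x) mem_fsum.
have : (#|` A `&` [fset f x | x in A]| <= 1)%N.
  rewrite -(cardfs1 L); apply: fsubset_leq_card; apply/fsubsetP => x.
  rewrite in_fsetI => /andP[/AI + /imfsetP[y /= /AI + xE]].
  by rewrite xE /f inE => *; apply/eqP; lia.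
lia.
Qed.

Lemma leq_card_top (A B X : {fset int}) :
  fsum B B `<=` fsum A A -> X `<=` fsum A A ->
  (forall x : int, x \in X -> x \notin fsum B B) ->
  (#|` fsum B B| + #|` X| <= #|` fsum A A|)%N.
Proof.
move=> sB sX XB; have /eqP <- : #|` fsum B B `|` X| == (#|` fsum B B| + #|` X|)%N.
  rewrite cardfsU (_ : _ `&` _ = fset0) ?cardfs0 ?subn0 //.
  by apply/fsetP => x; rewrite !inE; apply/negP => /andP[+ /XB /negP].
by apply: fsubset_leq_card; rewrite fsubUset sB.
Qed.

(** With B = A without L, d does not divide L, so L + x for x in B is not divisible by d and is no
    sum of B; L + L is too large to be one. Hence |2A| >= |2B| + |A| >= 3|A| - 3. *)
Lemma card_sumset_not_coprime (A : {fset int}) (L a d : int) :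
  spans A L -> spans (A `\ L) a -> coprime_set A -> `|d| <> 1 ->
  (forall x : int, x \in A `\ L -> (d %| x)%Z) ->
  (3 * #|` A| <= #|` fsum A A| + 3)%N.
Proof.
move=> [A0 AL AI] sB cop d1 dB; set B := A `\ L in sB dB *.
have [B0 Ba BI] := sB.
have dL : ~~ (d %| L)%Z.
  apply/negP => dL; apply: d1; apply: cop => x xA.
  by have [->|xL] := eqVneq x L => //; apply: dB; rewrite !inE xL.
have aL : a < L by move: Ba; rewrite !inE => /andP[+ /AI]; lia.
pose f (x : int) : int := L + x.
have fI : injective f by move=> x y; rewrite /f; lia.
have cA : #|` A| = #|` B|.+1 by rewrite (cardfsD1 L) AL.
have := leq_card_fsum_self sB.
have := @leq_card_top A B [fset f x | x in A].
rewrite card_fimg // => H.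
suff : (#|` fsum B B| + #|` A| <= #|` fsum A A|)%N by lia.
apply: H.
- by apply: fsumS; apply: fsubD1set.
- by apply/fsubsetP => _ /imfsetP[x /= xA ->]; apply: mem_fsum.
move=> _ /imfsetP[x /= xA ->]; apply/fsumP => -[y [z [yB zB]]]; rewrite /f => E.
have [xL|xL] := eqVneq x L; first by have := BI _ yB; have := BI _ zB; lia.
move/negP: dL; apply; have -> : L = y + z - x by lia.
by rewrite rpredB ?rpredD ?dB // !inE xL.
Qed.

(* Adding a new maximum L to B always creates the sums L + L and L + max B. *)
Lemma top_gap (A : {fset int}) (L a : int) :
  spans A L -> spans (A `\ L) a -> coprime_set A ->
  (#|` fsum A A| <= #|` fsum (A `\ L) (A `\ L)| + 2)%N -> L = a + 1.
Proof.
move=> [A0 AL AI] sB cop; set B := A `\ L in sB * => Rub.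
have [B0 Ba BI] := sB.
have aL : a < L by move: Ba; rewrite !inE => /andP[+ /AI]; lia.
have BA (x : int) : x \in B -> x \in A by rewrite !inE => /andP[].
have all_old (x : int) : x \in B -> x != a -> L + x \in fsum B B.
  move=> xB xa; apply/negPn/negP => xN; have xlt := BI _ xB.
  have := @leq_card_top A B (L + L |` (L + a |` [fset L + x])).
  rewrite !cardfsU1 cardfs1 !inE.
  rewrite (_ : L + a == L + x = false); last by apply/eqP; lia.
  rewrite (_ : L + L == L + a = false); last by apply/eqP; lia.
  rewrite (_ : L + L == L + x = false); last by apply/eqP; lia.
  move=> H; suff : (#|` fsum B B| + 3 <= #|` fsum A A|)%N by lia.
  apply: H.
  - by apply: fsumS; apply: fsubD1set.
  - by rewrite !fsubUset !fsub1set !mem_fsum // BA.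
  move=> y; rewrite !inE => /or3P[]/eqP-> //.
    by apply/fsumP => -[y1 [y2 [/BI + /BI + +]]]; lia.
  by apply/fsumP => -[y1 [y2 [/BI + /BI + +]]]; lia.
(* Descent on a - x: an old sum L + x = y + z gives a - x = (a - y) + (a - z) + (L - a), where both
   a - y and a - z are smaller than a - x. *)
have dvd (x : int) : x \in B -> (L - a %| a - x)%Z.
  move=> xB; have [n] := @nat_of_ge0 (a - x) ltac:(have := BI _ xB; lia).
  elim/ltn_ind: n x xB => n IH x xB nE.
  have [->|xa] := eqVneq x a; first by rewrite subrr dvdz0.
  have /fsumP[y [z [yB zB E]]] := all_old _ xB xa.
  have -> : a - x = (a - y) + (a - z) + (L - a) by lia.
  have [yI zI] := (BI _ yB, BI _ zB).
  have [y' y'E] := @nat_of_ge0 (a - y) ltac:(lia).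
  have [z' z'E] := @nat_of_ge0 (a - z) ltac:(lia).
  have dy : (L - a %| a - y)%Z by apply: (IH y') => //; lia.
  have dz : (L - a %| a - z)%Z by apply: (IH z') => //; lia.
  by apply: rpredD; [exact: rpredD|exact: dvdzz].
have : `|L - a| = 1; last lia.
apply: cop => x xA.
have dB (y : int) : y \in B -> (L - a %| y)%Z.
  move=> yB; rewrite -[y](_ : (a - 0) - (a - y) = y); last lia.
  by rewrite rpredB ?dvd.
have [->|xL] := eqVneq x L; last by apply: dB; rewrite !inE xL.
by rewrite -[L in (_ %| L)%Z](subrK a) rpredD ?dvdzz ?dB.
Qed.

Lemma spans_remove_max (A : {fset int}) (L : int) :
  spans A L -> 0 < L -> exists a : int, spans (A `\ L) a.
Proof.
move=> [A0 AL AI] L0.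
have [||a aA [aI amax]] := @exists_max_int (fun x => x \in A) 0 (L - 1) => //; first lia.
exists a; split=> [||x]; rewrite !inE.
- by rewrite A0 andbT; apply/eqP; lia.
- by rewrite aA andbT; apply/eqP; lia.
by move=> /andP[xL xA]; have := AI _ xA; have := amax _ xA; lia.
Qed.

(** At most L consecutive integers are distinct modulo L, so folding the run into [0, L) yields n
    residues covered by 2A; each x of [A] is also covered a second time, by x + L. *)
Lemma card_sumset_interval (A B : {fset int}) (L a c : int) (n : nat) :
  spans A L -> spans B a -> B `<=` A -> a < L -> n%:Z <= L ->
  (forall t : int, c <= t < c + n%:Z -> t \in fsum B B) ->
  (n + #|` A| <= #|` fsum A A|)%N.
Proof.
move=> [A0 AL AI] [B0 Ba BI] /fsubsetP BA aL nL cI.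
pose f (t : int) : int := if t < L then t else t - L.
have tI (t : int) : t \in zitv c n -> 0 <= t <= 2 * a.
  by rewrite mem_zitv => /cI /fsumP[y [z [/BI ? /BI ? ->]]]; lia.
have tR (t : int) : t \in zitv c n -> t \in fsum A A.
  rewrite mem_zitv => /cI; apply/fsubsetP/fsumS; exact/fsubsetP.
have Hn : (n <= #|` [fset f t | t in zitv c n]|)%N.
  rewrite -[n in (n <= _)%N](card_zitv c); apply: (@leq_card_inj _ _ f) => [x y|x xc].
    by rewrite !mem_zitv /f => xI yI; do 2![case: ifP => ?]; lia.
  by apply/imfsetP; exists x.
have /leq_trans : (n + #|` A| <= #|` [fset f t | t in zitv c n]| + #|` A|)%N by rewrite leq_add2r.
apply; apply: (@card_mod _ _ _ L) => [t|t|t tA].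
- by case/imfsetP => /= x xc ->; have := tI _ xc; rewrite /f; case: ifP; lia.
- case/imfsetP => /= x xc ->; have := tR _ xc.
  by rewrite /f; case: ifP => _ xR; rewrite ?xR ?orbT ?subrK // xR orbT.
split; first by have := AI _ tA; lia.
  exact: mem_fsum.
by move=> _; rewrite -(addr0 t) mem_fsum.
Qed.

Lemma coprime_set1 (A : {fset int}) (a : int) :
  a \in A -> a + 1 \in A -> coprime_set A.
Proof.
move=> aA a1A d dA; have : (d %| a + 1 - a)%Z by rewrite rpredB ?dA.
by rewrite (_ : a + 1 - a = 1); [rewrite dvdz1; lia|lia].
Qed.

Definition mirror (A : {fset int}) (L : int) : {fset int} :=
  [fset (L - x : int) | x in A].

Lemma mem_mirror (A : {fset int}) (L x : int) :
  (x \in mirror A L) = (L - x \in A).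
Proof.
apply/imfsetP/idP => /= [[y yA ->]|xA]; first by rewrite subKr.
by exists (L - x); rewrite ?subKr.
Qed.

Lemma card_mirror (A : {fset int}) (L : int) : #|` mirror A L| = #|` A|.
Proof. by rewrite card_fimg // => x y; lia. Qed.

Lemma fsum_mirror (A B : {fset int}) (L M : int) :
  fsum (mirror A L) (mirror B M) = mirror (fsum A B) (L + M).
Proof.
apply/fsetP => x; rewrite mem_mirror; apply/fsumP/fsumP => -[a [b]].
  by rewrite !mem_mirror => -[aA bB xE]; exists (L - a), (M - b); split => //; lia.
by move=> [aA bB xE]; exists (L - a), (M - b); rewrite !mem_mirror !subKr; split => //; lia.
Qed.

Lemma spans_mirror (A : {fset int}) (L : int) : spans A L -> spans (mirror A L) L.
Proof.
move=> [A0 AL AI]; split=> [||x]; rewrite mem_mirror ?subr0 ?subrr //.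
by move=> /AI; lia.
Qed.

Lemma coprime_mirror (A : {fset int}) (L : int) :
  0 \in A -> coprime_set A -> coprime_set (mirror A L).
Proof.
move=> A0 cop d dA; apply: cop => x xA.
have dL : (d %| L)%Z by apply: dA; rewrite mem_mirror subrr.
have -> : x = L - (L - x) by lia.
by apply: rpredB => //; apply: dA; rewrite mem_mirror subKr.
Qed.

Definition translate (A : {fset int}) (c : int) : {fset int} :=
  [fset (x + c : int) | x in A].

Lemma mem_translate (A : {fset int}) (c x : int) :
  (x \in translate A c) = (x - c \in A).
Proof.
apply/imfsetP/idP => /= [[y yA ->]|xA]; first by rewrite addrK.
by exists (x - c); rewrite ?subrK.
Qed.

Lemma card_translate (A : {fset int}) (c : int) : #|` translate A c| = #|` A|.
Proof. by rewrite card_fimg // => x y; lia. Qed.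

Lemma fsum_translate (A B : {fset int}) (c d : int) :
  fsum (translate A c) (translate B d) = translate (fsum A B) (c + d).
Proof.
apply/fsetP => x; rewrite mem_translate; apply/fsumP/fsumP => -[a [b]].
  by rewrite !mem_translate => -[aA bB xE]; exists (a - c), (b - d); split => //; lia.
by move=> [aA bB xE]; exists (a + c), (b + d); rewrite !mem_translate !addrK; split => //; lia.
Qed.

(** The first hypothesis is the induction hypothesis of [freiman_3k4]. Let B be [A] without L. It is
    coprime, or else |2A| >= 3k - 3. If |2B| <= 3|B| - 4, the induction hypothesis and
    [long_interval] give 2|B| - 1 consecutive sums, and again |2A| >= 3k - 3. So |2B| >= 3k - 6, at
    most two sums are new, and [top_gap] applies. *)
Lemma penultimate_mem (k : nat) (A : {fset int}) (L : int) :
  (forall (B : {fset int}) (M : int), (#|` B| < k)%N -> spans B M -> coprime_set B ->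
     (#|` fsum B B| + 4 <= 3 * #|` B|)%N -> M + #|` B|%:Z <= #|` fsum B B|%:Z) ->
  #|` A| = k -> spans A L -> coprime_set A ->
  (#|` fsum A A| + 4 <= 3 * k)%N -> 2 * k%:Z - 2 <= L -> L - 1 \in A.
Proof.
move=> IH Ak sA cop Aub Llb; have [A0 AL AI] := sA.
have k2 : (1 < k)%N by have := leq_card_fsum_self sA; lia.
have [a sB] := spans_remove_max sA ltac:(lia).
have [B0 Ba BI] := sB.
have cA : k = #|` A `\ L|.+1 by rewrite -Ak (cardfsD1 L) AL.
have aL : a < L by move: Ba; rewrite !inE => /andP[+ /AI]; lia.
have copB : coprime_set (A `\ L).
  move=> d dB; apply/eqP/negPn/negP => /eqP d1.
  by have := card_sumset_not_coprime sA sB cop d1 dB; lia.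
have Bnsmall : ~~ (#|` fsum (A `\ L) (A `\ L)| + 4 <= 3 * #|` A `\ L|)%N.
  apply/negP => Bub; have := IH (A `\ L) a ltac:(lia) sB copB Bub => aub.
  have [||c cI] := long_interval sB sB (lexx a); [lia|lia|].
  have := @card_sumset_interval A (A `\ L) L a c (2 * #|` A `\ L| - 1) sA sB (fsubD1set _ _) aL ltac:(lia).
  move=> H; suff /H : forall t : int, c <= t < c + (2 * #|` A `\ L| - 1)%N%:Z ->
    t \in fsum (A `\ L) (A `\ L) by lia.
  by move=> t tI; apply: cI; lia.
have LE : L = a + 1 by apply: (top_gap sA sB cop); lia.
by rewrite LE addrK; move: Ba; rewrite !inE => /andP[].
Qed.

(** Points of [A1] are at most l or equal to s, points of [A2] equal to l or at least s; comparing
    sizes, a common sum can only be 2l, l + s or 2s. *)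
Lemma card_fsetI_overlap (A A1 A2 : {fset int}) (l s : int) :
  l < s -> (forall x : int, x \in A -> ~~ (l < x < s)) ->
  (forall x : int, x \in A1 -> x \in A /\ x <= s) ->
  (forall x : int, x \in A2 -> x \in A /\ l <= x) ->
  (#|` fsum A1 A1 `&` fsum A2 A2| <= 3)%N.
Proof.
move=> ls gap A1I A2I.
apply: (@leq_trans #|` l + l |` (l + s |` [fset s + s])|).
  apply: fsubset_leq_card; apply/fsubsetP => t; rewrite in_fsetI => /andP[].
  case/fsumP => x [y [/A1I[/gap xg xs] /A1I[/gap yg ys] ->]].
  case/fsumP => z [w [/A2I[/gap zg zs] /A2I[/gap wg ws] E]].
  by rewrite !inE; lia.
by rewrite !cardfsU1 cardfs1; do 2![case: (_ \notin _)].
Qed.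

(* When L is large, the induction reduces to the case 1, L - 1 \in A, where A is
   cut between two consecutive elements l < s: the sums of the elements up to s
   and those of the elements from l on share at most the sums 2l, l + s, 2s. *)
Lemma freiman_3k4 (A : {fset int}) (L : int) :
  spans A L -> coprime_set A -> (#|` fsum A A| + 4 <= 3 * #|` A|)%N ->
  L + #|` A|%:Z <= #|` fsum A A|%:Z.
Proof.
have [k Ak] : exists k, #|` A| = k by exists #|` A|.
elim/ltn_ind: k A L Ak => k IH A L Ak sA cop Aub; have [A0 AL AI] := sA.
have {}IH (B : {fset int}) (M : int) : (#|` B| < k)%N -> spans B M -> coprime_set B ->
     (#|` fsum B B| + 4 <= 3 * #|` B|)%N -> M + #|` B|%:Z <= #|` fsum B B|%:Z.
  by move=> Bk; apply: (IH #|` B|) erefl.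
case: (lerP (L + 3) (2 * #|` A|%:Z)) => [/(card_sumset_dense sA)//|Llb].
exfalso; rewrite Ak in Aub Llb.
have k2 : (1 < k)%N by have := leq_card_fsum_self sA; lia.
have L1A : L - 1 \in A by apply: (penultimate_mem IH Ak sA cop); lia.
have A1 : 1 \in A.
  rewrite -[1](subKr L) -mem_mirror; apply: (penultimate_mem IH _ (spans_mirror sA)).
  - by rewrite card_mirror.
  - exact: coprime_mirror.
  - by rewrite fsum_mirror card_mirror; lia.
  - lia.
have [below belowE] : exists below : int -> nat, forall x, below x = #|` seg A 0 (x - 1)|.
  by exists (fun x => #|` seg A 0 (x - 1)|).
(* Negated, so that a maximum of [P] gives the least s > 1 in [A] with s >= 2|A ∩ [0, s]| - 3: from
   there on the lower piece is too long for the conclusion of the theorem. The element L - 1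
   qualifies. *)
have [P PE] : exists P : pred int, forall x, P x =
    (- x \in A) && (1 < - x) && (- x + 1 >= 2 * (below (- x))%:Z).
  by exists (fun x => (- x \in A) && (1 < - x) && (- x + 1 >= 2 * (below (- x))%:Z)).
have below_top (x : int) : x \in A -> #|` seg A 0 x| = (below x).+1.
  move=> xA; rewrite belowE (_ : seg A 0 x = x |` seg A 0 (x - 1)).
    by rewrite cardfsU1 mem_seg xA /= (_ : 0 <= x <= x - 1 = false) //; lia.
  apply/fsetP => y; rewrite in_fset1U !mem_seg.
  by have [->|] := eqVneq y x; [have := AI _ xA; rewrite xA|]; lia.
have above (x : int) : x \in A -> (#|` seg A x L| + below x = k)%N.
  move=> xA; have := cardfsUI (seg A 0 (x - 1)) (seg A x L).
  rewrite (_ : _ `&` _ = fset0); last by apply/fsetP => y; rewrite in_fsetI !mem_seg in_fset0; lia.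
  rewrite (_ : _ `|` _ = A) ?cardfs0; first by rewrite Ak addn0 addnC belowE => ->.
  apply/fsetP => y; rewrite in_fsetU !mem_seg.
  by case: (boolP (y \in A)) => [/AI|]; lia.
have two (S : {fset int}) (x y : int) : x \in S -> y \in S -> x < y -> (1 < #|` S|)%N.
  move=> xS yS xy; have /fsubset_leq_card : [fset x; y] `<=` S.
    by rewrite fsubUset !fsub1set xS.
  by rewrite cardfs2; have -> : x != y by lia.
have L3 : 3 <= L.
  have := below_top L AL; have := fsubset_leq_card (seg_sub A 0 L).
  rewrite Ak; have := two (seg A 0 (L - 1)) 0 1.
  by rewrite !mem_seg A0 A1 !andTb => /(_ ltac:(lia) ltac:(lia) isT); rewrite -belowE; lia.
have [||s' Ps [sI smax]] := @exists_max_int P (1 - L) (-2).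
- lia.
- rewrite PE (_ : - (1 - L) = L - 1) ?L1A ?andTb; last lia; apply/andP; split; first lia.
  have := above (L - 1) L1A; have := two (seg A (L - 1) L) (L - 1) L.
  by rewrite !mem_seg L1A AL !andTb => /(_ ltac:(lia) ltac:(lia) ltac:(lia)); lia.
have [s sE] : exists s, s = - s' by exists (- s').
move: Ps; rewrite PE -sE => /andP[/andP[sA1 s1] sbelow].
have [||l lA [lI lmax]] := @exists_max_int (fun x => x \in A) 1 (s - 1); rewrite ?A1 //; first lia.
(* Because l fails the test or is 1, the upper piece is too long as well: L - l >= 2|A ∩ [l, L]| -
   3. *)
have lbelow : l <= 2 * (below l)%:Z + L - 2 * k%:Z + 3.
  have [l1|l1] := eqVneq l 1.
    have : (0 < below l)%N by rewrite belowE cardfs_gt0; apply/fset0Pn; exists 0; rewrite mem_seg A0; lia.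
    lia.
  by have := smax (- l); rewrite PE opprK lA andTb; lia.
have gap (x : int) : x \in A -> ~~ (l < x < s).
  by move=> xA; have := lmax x xA; lia.
pose X := seg A 0 s; pose Y := seg A l L.
pose Y0 := translate Y (- l).
have sX : spans X s.
  by split=> [||x]; rewrite mem_seg ?A0 ?sA1 /=; lia.
have sY : spans Y0 (L - l).
  split=> [||x]; rewrite mem_translate mem_seg.
  - by rewrite sub0r opprK lA; lia.
  - by rewrite opprK subrK AL; lia.
  by lia.
have copX : coprime_set X by apply: (@coprime_set1 _ 0); rewrite mem_seg ?A0 ?A1 /=; lia.
have copY : coprime_set Y0.
  apply: (@coprime_set1 _ (L - 1 - l)); rewrite mem_translate mem_seg.
    by rewrite opprK subrK L1A /=; lia.
  by rewrite opprK (_ : _ + l = L) ?AL /=; lia.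
have cX : #|` X| = (below s).+1 by apply: below_top.
have cY : (#|` Y0| + below l = k)%N by rewrite card_translate; apply: above.
have bls : below s = (below l).+1.
  rewrite -below_top // belowE; congr (#|` _|); apply/fsetP => x; rewrite !mem_seg.
  by case: (boolP (x \in A)) => [/gap|]; lia.
have Xbig : (3 * #|` X| <= #|` fsum X X| + 3)%N.
  rewrite leqNgt; apply/negP => small; have Xk : (#|` X| < k)%N.
    have := above _ sA1; have := two (seg A s L) s L.
    by rewrite !mem_seg sA1 AL !andTb => /(_ ltac:(lia) ltac:(lia) ltac:(lia)); lia.
  by have := IH X s Xk sX copX ltac:(lia); lia.
have Ybig : (3 * #|` Y| <= #|` fsum Y Y| + 3)%N.
  have l0 : (0 < below l)%N.
    by rewrite belowE cardfs_gt0; apply/fset0Pn; exists 0; rewrite mem_seg A0; lia.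
  rewrite leqNgt; apply/negP => small.
  have := IH Y0 (L - l) ltac:(lia) sY copY.
  by move: cY; rewrite fsum_translate !card_translate; lia.
(* As |X| + |Y| = k + 2, the two pieces give |2A| >= 3(k + 2) - 6 - 3 = 3k - 3, the
   contradiction. *)
have := @card_fsetI_overlap A X Y l s ltac:(lia) gap.
have := cardfsUI (fsum X X) (fsum Y Y).
have : (#|` fsum X X `|` fsum Y Y| <= #|` fsum A A|)%N.
  by apply: fsubset_leq_card; rewrite fsubUset !fsumS // seg_sub.
move=> UA UI /(_ _ _) XY3; suff : (#|` fsum X X `&` fsum Y Y| <= 3)%N.
  by move: cY Ybig; rewrite card_translate; lia.
by apply: XY3 => x; rewrite mem_seg => /andP[-> xI]; split => //; lia.
Qed.

(** * Transfer to Z/pZ *)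

Lemma card_Zp_prime (p : nat) : prime p -> #|'Z_p| = p.
Proof. by move=> p_pr; rewrite card_ord Zp_cast ?prime_gt1. Qed.

Lemma intr_Zp_eq0 (p : nat) (t : int) : prime p -> (t%:~R == 0 :> 'Z_p) = (p %| t)%Z.
Proof.
move=> p_pr; have natE (n : nat) : (n%:R == 0 :> 'Z_p) = (p %| n)%N.
  by rewrite -val_eqE /= val_Zp_nat ?prime_gt1.
case: t => n; first by rewrite -pmulrn natE.
by rewrite NegzE mulrNz oppr_eq0 -pmulrn natE dvdzE abszN.
Qed.

Lemma unit_Zp_prime (p : nat) (g : 'Z_p) : prime p -> g != 0 -> g \is a GRing.unit.
Proof.
move=> p_pr g0; have p1 := prime_gt1 p_pr.
rewrite -[g]natr_Zp unitZpE // prime_coprime //; apply: contra g0.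
have : (g < p)%N by rewrite -[X in (_ < X)%N](Zp_cast p1) ltn_ord.
by move=> gp; rewrite /dvdn modn_small.
Qed.

Lemma mulrz_Zp_inj (p : nat) (g : 'Z_p) (x y : int) :
  prime p -> g != 0 -> g *~ x = g *~ y -> (p %| x - y)%Z.
Proof.
move=> p_pr g0 /eqP; rewrite -subr_eq0 -mulrzBr -mulrzr => /eqP E.
rewrite -intr_Zp_eq0 //; apply/eqP; apply: (mulrI (unit_Zp_prime p_pr g0)).
by rewrite E mulr0.
Qed.

Lemma mulrz_Zp_surj (p : nat) (b g z : 'Z_p) :
  prime p -> g != 0 -> exists2 t : int, 0 <= t < p%:Z & z = b + g *~ t.
Proof.
move=> p_pr g0; have p1 := prime_gt1 p_pr.
exists (nat_of_ord ((z - b) / g))%:Z.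
  have := ltn_ord ((z - b) / g); rewrite [X in (_ < X)%N -> _](Zp_cast p1); lia.
rewrite -pmulrn -[_ *+ _]mulr_natr natr_Zp mulrC divrK ?unit_Zp_prime //.
by rewrite addrC subrK.
Qed.

(** The affine image b + g X. It always commutes with sumsets, and it preserves cardinality when [X]
    lies in p consecutive integers and g is nonzero. *)
Definition img (p : nat) (b g : 'Z_p) (X : {fset int}) : {set 'Z_p} :=
  [set:: [seq b + g *~ x | x <- enum_fset X]].

Lemma imgP (p : nat) (b g : 'Z_p) (X : {fset int}) (z : 'Z_p) :
  reflect (exists2 x : int, x \in X & z = b + g *~ x) (z \in img b g X).
Proof. by rewrite inE; apply: mapP. Qed.

Lemma mem_img (p : nat) (b g : 'Z_p) (X : {fset int}) (x : int) :
  x \in X -> b + g *~ x \in img b g X.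
Proof. by move=> xX; apply/imgP; exists x. Qed.

Lemma img_inj (p : nat) (b g : 'Z_p) (a x y : int) :
  prime p -> g != 0 -> a <= x < a + p%:Z -> a <= y < a + p%:Z ->
  b + g *~ x = b + g *~ y -> x = y.
Proof.
move=> p_pr g0 xI yI /addrI /(mulrz_Zp_inj p_pr g0) /dvdzP[q qE].
have p0 := prime_gt0 p_pr; have : q = 0 by nia.
by move=> q0; move: qE; rewrite q0; lia.
Qed.

Lemma card_img (p : nat) (b g : 'Z_p) (X : {fset int}) (a : int) :
  prime p -> g != 0 -> (forall x : int, x \in X -> a <= x < a + p%:Z) ->
  #|img b g X| = #|` X|.
Proof.
move=> p_pr g0 XI; rewrite cardsE -(size_map (fun x => b + g *~ x)).
apply/card_uniqP; rewrite map_inj_in_uniq ?fset_uniq // => x y xX yX.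
by apply: (img_inj (a:=a)) => //; apply: XI.
Qed.

Lemma sumset_img (p : nat) (b c g : 'Z_p) (X Y : {fset int}) :
  sumset (img b g X) (img c g Y) = img (b + c) g (fsum X Y).
Proof.
apply/setP => z; apply/imset2P/imgP => /= [[u v /imgP[x xX ->] /imgP[y yY ->] ->]|].
  exists (x + y); first exact: mem_fsum.
  by rewrite mulrzDr addrACA.
case=> _ /fsumP[x [y [xX yY ->]]] ->.
exists (b + g *~ x) (c + g *~ y); rewrite ?mem_img //.
by rewrite mulrzDr addrACA.
Qed.

Lemma img_translate (p : nat) (b g : 'Z_p) (X : {fset int}) (c : int) :
  img b g X = img (b + g *~ c) g (translate X (- c)).
Proof.
apply/setP => z; apply/imgP/imgP => -[x xX ->].
  exists (x - c); last by rewrite -addrA -mulrzDr [c + _]addrC subrK.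
  by rewrite mem_translate opprK subrK.
move: xX; rewrite mem_translate opprK => xX; exists (x + c) => //.
by rewrite -addrA -mulrzDr [c + _]addrC.
Qed.

Lemma spans_translate (X : {fset int}) (a b : int) :
  X != fset0 -> (forall x : int, x \in X -> a <= x <= b) ->
  exists c L : int, L <= b - a /\ spans (translate X (- c)) L.
Proof.
move=> /fset0Pn[x0 x0X] XI; have x0I := XI _ x0X.
have [||u uX [uI umax]] := @exists_max_int (fun x => x \in X) x0 b => //; first lia.
have [||v' vX [vI vmin]] := @exists_max_int (fun x => - x \in X) (- x0) (- a).
- lia.
- by rewrite opprK.
have [v vE] : exists v, v' = - v by exists (- v'); rewrite opprK.
rewrite vE opprK in vX vI vmin.
have := XI _ uX; have := XI _ vX => *.
exists v, (u - v); split; first lia.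
split=> [||x]; rewrite mem_translate opprK ?add0r ?subrK // => xX.
have := umax _ xX; have := vmin (- (x + v)); rewrite opprK xX => /(_ isT).
have := XI _ xX; lia.
Qed.

Definition gcd_set (X : {fset int}) : int := foldr gcdz 0 X.

Lemma dvdz_gcd_set (X : {fset int}) (d : int) :
  (d %| gcd_set X)%Z = all (fun x => (d %| x)%Z) X.
Proof.
rewrite /gcd_set; elim: (enum_fset X) => [|x s IH] /=; first by rewrite dvdz0.
by rewrite dvdz_gcd IH.
Qed.

Lemma gcd_set_dvd (X : {fset int}) (x : int) : x \in X -> (gcd_set X %| x)%Z.
Proof. by move=> xX; have := dvdzz (gcd_set X); rewrite dvdz_gcd_set => /allP/(_ x xX). Qed.

(** The gcd d of [X] is moved into the difference, g becoming g d; this is nonzero because 0 < d <=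
    L < p. *)
Lemma img_coprime (p : nat) (b g : 'Z_p) (X : {fset int}) (L : int) :
  prime p -> g != 0 -> spans X L -> 0 < L < p%:Z ->
  exists (g' : 'Z_p) (X' : {fset int}) (L' : int), [/\ g' != 0, img b g X = img b g' X', spans X' L', coprime_set X' & L' <= L].
Proof.
move=> p_pr g0 [X0 XL XI] Lp.
have [d [d_ge0 dvd dmax]] : exists d : int, [/\ 0 <= d,
    forall x : int, x \in X -> (d %| x)%Z &
    forall e : int, (forall x : int, x \in X -> (e %| x)%Z) -> (e %| d)%Z].
  exists (gcd_set X); split; [|exact: gcd_set_dvd|].
    by rewrite /gcd_set; case: (enum_fset X).
  by move=> e eX; rewrite dvdz_gcd_set; apply/allP.
have dL : d != 0 by apply: contraTneq (dvd _ XL) => ->; rewrite dvd0z; lia.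
have d0 : 0 < d by lia.
have divdK (x : int) : x \in X -> (x %/ d)%Z * d = x by move=> /dvd /divzK.
have dleL : d <= L by have := dvd _ XL; rewrite dvdzE => /dvdn_leq; lia.
exists (g *~ d), [fset (x %/ d)%Z | x in X], (L %/ d)%Z; split.
- apply/eqP => E; have := @mulrz_Zp_inj p g d 0 p_pr g0.
  rewrite E mulr0z => /(_ erefl); rewrite subr0 dvdzE => /dvdn_leq; lia.
- apply/setP => z; apply/imgP/imgP => [[x xX ->]|[_ /imfsetP[x /= xX ->] ->]].
    exists (x %/ d)%Z; first by apply/imfsetP; exists x.
    by rewrite -mulrzA mulrC divdK.
  by exists x => //; rewrite -mulrzA mulrC divdK.
- split=> [||_ /imfsetP[x /= xX ->]].
  + by apply/imfsetP; exists 0; rewrite ?div0z.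
  + by apply/imfsetP; exists L.
  by rewrite -(ler_pM2r d0) -[(x %/ d <= _)%Z](ler_pM2r d0) mul0r !divdK // XI.
- move=> e eX; have : (e * d %| d)%Z.
    apply: dmax => x xX; rewrite -(divdK x xX) dvdz_mul //.
    by apply: eX; apply/imfsetP; exists x.
  rewrite -[d in (_ %| d)%Z]mul1r dvdz_mul2r // dvdz1; lia.
by have := divdK _ XL; move: (L %/ d)%Z => v; nia.
Qed.

(** The bound 2L < p puts X + X inside p consecutive integers, so [A] and 2A have the sizes of [X]
    and 2X. *)
Record zp_model (p : nat) (A : {set 'Z_p}) (b g : 'Z_p) (X : {fset int}) (L : int) : Prop :=
  ZpModel { _ : g != 0; _ : A = img b g X; _ : spans X L; _ : 2 * L < p%:Z }.

Lemma card_zp_model (p : nat) (A : {set 'Z_p}) (b g : 'Z_p) (X : {fset int}) (L : int) :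
  prime p -> zp_model A b g X L ->
  #|A| = #|` X| /\ #|sumset A A| = #|` fsum X X|.
Proof.
move=> p_pr [g0 -> [X0 XL XI] L2]; have L0 := XI _ X0.
rewrite sumset_img !(@card_img _ _ _ _ 0) //.
  by move=> x /fsumP[y [z [/XI yI /XI zI ->]]]; lia.
by move=> x /XI; lia.
Qed.

(** After translation and division by the gcd, [freiman_3k4] bounds the length of the model, and
    that bound is what [long_interval] asks for. Applied to the part A' and then to A. *)
Lemma freiman_Zp (p : nat) (b g : 'Z_p) (X : {fset int}) (a q : int) (A : {set 'Z_p}) :
  prime p -> g != 0 -> (forall x : int, x \in X -> a <= x <= a + q) -> 2 * q < p%:Z ->
  A = img b g X -> (1 < #|A|)%N -> (#|sumset A A| + 4 <= 3 * #|A|)%N ->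
  exists (b' g' : 'Z_p) (X' : {fset int}) (L c : int), [/\ zp_model A b' g' X' L, L + #|A|%:Z <= #|sumset A A|%:Z &
    forall t : int, c <= t < c + 2 * #|A|%:Z - 1 -> t \in fsum X' X'].
Proof.
move=> p_pr g0 XI q2 AE A1 small.
have X0 : X != fset0.
  apply: contraTneq A1 => X0; rewrite AE X0 -leqNgt.
  by rewrite (@card_img _ _ _ _ 0) ?cardfs0.
have [c [L [LI sX]]] := spans_translate X0 XI.
rewrite (img_translate _ _ _ c) in AE.
have AXL : zp_model A (b + g *~ c) g (translate X (- c)) L by split => //; lia.
have L0 : 0 < L.
  have [cA _] := card_zp_model p_pr AXL; have [Y0 YL YI] := sX.
  have := YI _ YL; rewrite le0r => /andP[/orP[/eqP L0|//] _].
  have /fsubset_leq_card : translate X (- c) `<=` [fset 0].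
    by apply/fsubsetP => x /YI; rewrite inE; lia.
  rewrite cardfs1; lia.
have [g' [X' [L' [g'0 imgE sX' cop LL']]]] := img_coprime (b + g *~ c) p_pr g0 sX ltac:(lia).
have AXL' : zp_model A (b + g *~ c) g' X' L' by split => //; [rewrite AE|lia].
have [cA cS] := card_zp_model p_pr AXL'.
have Lub : L' + #|` X'|%:Z <= #|` fsum X' X'|%:Z by apply: freiman_3k4 => //; lia.
have [||e eI] := long_interval sX' sX' (lexx L'); [lia|lia|].
exists (b + g *~ c), g', X', L', e; split => //; first by rewrite cA cS.
by move=> t tI; apply: eI; lia.
Qed.

(** Represents the negative of a set with the same difference, so that T - A' becomes a sumset of
    images. *)
Lemma img_mirror (p : nat) (b g : 'Z_p) (X : {fset int}) (L : int) (z : 'Z_p) :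
  (z \in img (- b - g *~ L) g (mirror X L)) = (- z \in img b g X).
Proof.
apply/imgP/imgP => -[x xX zE].
  exists (L - x); first by rewrite -mem_mirror.
  by rewrite zE mulrzBr !opprD !opprK addrA.
exists (L - x); first by rewrite mem_mirror subKr.
by rewrite -[z]opprK zE mulrzBr opprD addrA subrK.
Qed.

Lemma card_sumset_ge (p : nat) (A : {set 'Z_p}) : (#|A| <= #|sumset A A|)%N.
Proof.
have [->|/set0Pn[a aA]] := eqVneq A set0; first by rewrite cards0.
rewrite -(card_imset (mem A) (addrI a)); apply/subset_leq_card/subsetP => z.
by case/imsetP => x xA ->; apply/imset2P; exists a x.
Qed.

(* A' + A' contains a progression of length 2|A'| - 1, so the complement T of
   A + A lies in a progression of length p - 2|A'| + 1 with the same difference.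
   Hence T - A' is the image of a sum of two sets of integers, and since it
   avoids A it is small enough to contain a long progression in turn. *)
Lemma cover_by_AP (p : nat) (A A' : {set 'Z_p}) (b g : 'Z_p) (X : {fset int}) (L c : int) :
  prime p -> A' \subset A -> zp_model A' b g X L ->
  (#|sumset A A| + #|A| <= p)%N -> (#|sumset A A| + 4 <= 3 * #|A'|)%N ->
  L + #|A'|%:Z <= #|sumset A' A'|%:Z ->
  (forall t : int, c <= t < c + 2 * #|A'|%:Z - 1 -> t \in fsum X X) ->
  exists (b' : 'Z_p) (Z : {fset int}), A = img b' g Z /\
    forall x : int, x \in Z -> 0 <= x <= 0 + (#|sumset A A|%:Z - #|A'|%:Z).
Proof.
move=> p_pr A'A AX pub small Lub cI; have [g0 A'E sX L2] := AX.
have [cA' cS'] := card_zp_model p_pr AX.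
set S := sumset A A in pub small *; set n := #|A'| in small Lub cI cA' *.
have nN : (n <= #|A|)%N by apply: subset_leq_card.
have S'S : (#|sumset A' A'| <= #|S|)%N by apply/subset_leq_card/imset2S.
pose e := b + b + g *~ (c + 2 * n%:Z - 1).
pose W : {fset int} := [fset y in zitv 0 (p + 1 - 2 * n) | e + g *~ y \in ~: S].
have WE : ~: S = img e g W.
  apply/setP => z; apply/idP/imgP => [zS|[y]]; last by rewrite !inE => /andP[_ yS] ->.
  have [t tI zE] := mulrz_Zp_surj (b + b + g *~ c) z p_pr g0.
  have tn : 2 * n%:Z - 1 <= t.
    rewrite leNgt; apply: contraTN zS => tn; rewrite inE negbK zE -addrA -mulrzDr.
    have : b + b + g *~ (c + t) \in sumset A' A'.
      by rewrite A'E sumset_img; apply/mem_img/cI; lia.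
    by apply/subsetP/imset2S.
  have zE' : z = e + g *~ (t - (2 * n%:Z - 1)).
    by rewrite zE /e -!addrA -!mulrzDr; congr (_ + (_ + g *~ _)); lia.
  by exists (t - (2 * n%:Z - 1)) => //; rewrite !inE mem_zitv -zE' -in_setC zS; lia.
have p2n : (2 * n <= p)%N by have := card_sumset_ge A; rewrite -/S; lia.
have cW : #|` W|%:Z = p%:Z - #|S|%:Z.
  have := cardsC S; rewrite card_Zp_prime // WE (@card_img _ _ _ _ 0) //; first lia.
  by move=> x; rewrite !inE mem_zitv => /andP[+ _]; lia.
have W0 : W != fset0 by rewrite -cardfs_gt0 -ltz_nat cW; lia.
have WI (x : int) : x \in W -> 0 <= x <= p%:Z - 2 * n%:Z.
  by rewrite !inE mem_zitv => /andP[+ _]; lia.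
have [c1 [M [MI sY]]] := spans_translate W0 WI.
have cY := card_translate W (- c1).
rewrite (img_translate _ _ _ c1) in WE.
move: (translate W (- c1)) (e + g *~ c1) sY cY WE => Y e1 sY cY WE.
have sX1 := spans_mirror sX; have cX1 := card_mirror X L.
have imgE := img_mirror b g X L.
move: (mirror X L) (- b - g *~ L) sX1 cX1 imgE => X1 b1 sX1 cX1 imgE.
have [[_ _ X1I] [_ _ YI]] := (sX1, sY).
have RA : img (b1 + e1) g (fsum X1 Y) \subset ~: A.
  rewrite -sumset_img -WE; apply/subsetP => _ /imset2P[u v uX vS ->].
  rewrite inE; apply: contraL vS => zA; rewrite inE negbK.
  rewrite -[v](addKr u) addrC; apply/imset2P; exists (u + v) (- u) => //.
  by apply: (subsetP A'A); rewrite A'E -imgE.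
have cR : #|` fsum X1 Y|%:Z <= p%:Z - #|A|%:Z.
  have := subset_leq_card RA; have := cardsC A; rewrite card_Zp_prime //.
  rewrite (@card_img _ _ _ _ 0) //; first lia.
  by move=> x /fsumP[y [z [/X1I + /YI + ->]]]; lia.
clearbody W S n.
(* [long_interval] takes the wider set first, hence two cases. Its size hypotheses follow from |R|
   <= p - |A|, |S| + |A| <= p and |S| + 4 <= 3n. *)
have [c2 c2I] : exists c2 : int, forall t : int,
    c2 <= t < c2 + n%:Z + #|` Y|%:Z - 1 -> t \in fsum X1 Y.
  case: (lerP M L) => [ML|LM].
    have [||c2 c2I] := long_interval sX1 sY ML; [lia|lia|].
    by exists c2 => t tI; apply: c2I; lia.
  have [||c2 c2I] := long_interval sY sX1 (ltW LM); [lia|rewrite fsumC; lia|].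
  by exists c2 => t tI; rewrite fsumC; apply: c2I; lia.
(* The point right after the run of n + (p - |S|) - 1 points that avoid [A]; the offsets left for
   [A] number |S| - n + 1. *)
pose e2 := b1 + e1 + g *~ (c2 + n%:Z + #|` Y|%:Z - 1).
exists e2, [fset y in zitv 0 (#|S| + 1 - n) | e2 + g *~ y \in A]; split; last first.
  by move=> x; rewrite !inE mem_zitv => /andP[+ _]; lia.
apply/setP => z; apply/idP/imgP => [zA|[y]]; last by rewrite !inE => /andP[_ yS] ->.
have [t tI zE] := mulrz_Zp_surj (b1 + e1 + g *~ c2) z p_pr g0.
have tn : n%:Z + #|` Y|%:Z - 1 <= t.
  rewrite leNgt; apply: contraTN zA => tn; rewrite zE -addrA -mulrzDr -in_setC.
  by apply: (subsetP RA); apply/mem_img/c2I; lia.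
have zE' : z = e2 + g *~ (t - (n%:Z + #|` Y|%:Z - 1)).
  by rewrite zE /e2 -!addrA -!mulrzDr; congr (_ + (_ + g *~ _)); lia.
by exists (t - (n%:Z + #|` Y|%:Z - 1)) => //; rewrite !inE mem_zitv -zE' zA andbT; lia.
Qed.

Lemma is_AP_img (p : nat) (b g : 'Z_p) (k : nat) :
  prime p -> g != 0 -> (0 < k <= p)%N ->
  is_AP g (img b g (zitv 0 k)) /\ #|img b g (zitv 0 k)| = k.
Proof.
move=> p_pr g0 kp; split; last first.
  rewrite (@card_img _ _ _ _ 0) ?card_zitv // => x.
  by rewrite mem_zitv; lia.
split=> //; exists b, k; split => //; apply/setP => z; apply/imgP/imsetP => [[x]|[i _ ->]].
  rewrite mem_zitv => xI ->; have xk : (absz x < k)%N by lia.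
  by exists (Ordinal xk) => //=; rewrite pmulrn; congr (_ + g *~ _); lia.
by exists (nat_of_ord i)%:Z; [rewrite mem_zitv; have := ltn_ord i; lia|rewrite pmulrn].
Qed.

Lemma AP_structure (p : nat) (A : {set 'Z_p}) (b g : 'Z_p) (X : {fset int}) (a q : int) :
  prime p -> g != 0 -> (forall x : int, x \in X -> a <= x <= a + q) -> 2 * q < p%:Z ->
  img b g X \subset A -> (#|sumset A A| + #|A| <= p)%N ->
  (#|sumset A A| + 4 <= 3 * #|img b g X|)%N ->
  exists (h : 'Z_p) (PA P2A : {set 'Z_p}),
    is_AP h PA /\ is_AP h P2A /\ A \subset PA /\
    (#|PA|%:Z <= #|sumset A A|%:Z - #|A|%:Z + 1)%R /\
    P2A \subset sumset A A /\ (2 * #|A| - 1 <= #|P2A|)%N.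
Proof.
move=> p_pr g0 XI q2 XA pub small; set A' := img b g X in XA small.
have nN : (#|A'| <= #|A|)%N by apply: subset_leq_card.
have NS := card_sumset_ge A.
have S'S : (#|sumset A' A'| <= #|sumset A A|)%N by apply/subset_leq_card/imset2S.
have [||b1 [g1 [X1 [L1 [c1 [A'X L1ub c1I]]]]]] := @freiman_Zp p b g X a q A' p_pr g0 XI q2 erefl; [lia|lia|].
have [b2 [Z [AZ ZI]]] := cover_by_AP p_pr XA A'X pub small L1ub c1I.
have [g1' _ _ _] := A'X.
(* Here 2(|2A| - |A'|) < p because |2A| <= p - |A| and |2A| <= 3|A'| - 4. *)
have [|||b3 [g3 [Y [L [c [AY Lub cI]]]]]] := freiman_Zp p_pr g1' ZI _ AZ; [lia|lia|lia|].
have [g3' AE [Y0 YL YI] L2] := AY; have L0 := YI _ YL.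
have [k kE] := @nat_of_ge0 (L + 1) ltac:(lia).
have [PAP cP] := @is_AP_img p b3 g3 k p_pr g3' ltac:(lia).
have [QAP cQ] := @is_AP_img p (b3 + b3 + g3 *~ c) g3 (2 * #|A| - 1) p_pr g3' ltac:(lia).
exists g3, (img b3 g3 (zitv 0 k)), (img (b3 + b3 + g3 *~ c) g3 (zitv 0 (2 * #|A| - 1))).
split=> //; split=> //; split; last split; last split.
- apply/subsetP => z; rewrite AE => /imgP[x /YI xI ->].
  by apply: mem_img; rewrite mem_zitv; lia.
- by rewrite cP; lia.
- apply/subsetP => z /imgP[x]; rewrite mem_zitv => xI ->.
  by rewrite AE sumset_img -addrA -mulrzDr; apply/mem_img/cI; lia.
- by rewrite cQ.
Qed.

(** * Sums of cosines over subsets of Z/pZ *)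

Local Close Scope fset_scope.

(** A discrete layer cake: the sum is the integral over c in [0, c0] of the number of values above c
    minus the number below -c, which is at most D. The induction strips the lowest layer, whose
    height v is the least absolute value: every value moves towards 0 by v, one index reaches 0 and
    is dropped, and the levels shift by v. *)
Lemma layer_bound (F : realFieldType) (T : finType) (B : {set T}) (h : T -> F) (c0 : F) (D : nat) :
  0 <= c0 -> (forall i, i \in B -> `|h i| <= c0) ->
  (forall c : F, 0 <= c < c0 ->
    (#|[set i in B | (c < h i)%R]| <= #|[set i in B | (h i < - c)%R]| + D)%N) ->
  \sum_(i in B) h i <= D%:R * c0.
Proof.
have [n nE] : exists n, #|B| = n by exists #|B|.
elim: n B h c0 nE => [|n IH] B h c0 nE c0_ge0 hB level.
  by rewrite (cards0_eq nE) big_set0 mulr_ge0 ?ler0n.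
have [i1 i1B] : exists i, i \in B by apply/set0Pn; rewrite -card_gt0 nE.
have [i0 i0B vmin] := @arg_minP _ _ _ i1 (fun i => i \in B) (fun i => `|h i|) i1B.
set v := `|h i0| in vmin.
have v0 : 0 <= v by apply: normr_ge0.
have vc : v <= c0 by apply: hB.
pose s i : F := (0 < h i)%R%:R - (h i < 0)%R%:R.
pose h' i := h i - v * s i.
have h'E i : i \in B -> `|h' i| = `|h i| - v.
  move=> iB; have := vmin i iB; rewrite /h' /s.
  case: (ltgtP (h i) 0) => hi vi /=.
  - by rewrite sub0r mulrN mulr1 opprK; move: vi; rewrite [ `|h i|]ltr0_norm // => vi; rewrite ler0_norm; lra.
  - by rewrite subr0 mulr1; move: vi; rewrite [ `|h i|]gtr0_norm // => vi; rewrite ger0_norm; lra.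
  - by move: vi; rewrite hi subr0 mulr0 subr0 normr0; lra.
have -> : \sum_(i in B) h i = \sum_(i in B :\ i0) h' i + v * \sum_(i in B) s i.
  rewrite mulr_sumr [LHS](eq_bigr (fun i => h' i + v * s i)); last by move=> i _; rewrite /h' subrK.
  rewrite big_split /= (big_setD1 i0) //=; congr (_ + _).
  have /eqP : `|h' i0| = 0 by rewrite h'E // subrr.
  by rewrite normr_eq0 => /eqP ->; rewrite add0r.
have sumS : v * \sum_(i in B) s i <= v * D%:R.
  move: (v0); rewrite le0r => /orP[/eqP ->|v_gt0]; first by rewrite !mul0r.
  rewrite ler_pM2l // sumrB -!natr_sum lerBlDl -natrD ler_nat.
  have := level 0 ltac:(lra); rewrite oppr0 -!sum1_card.
  rewrite !big_mkcond /= => lev0.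
  have cnt (P : pred T) : (\sum_(i in B) P i = #|[set i in B | P i]|)%N.
    rewrite -sum1_card [RHS]big_mkcond [LHS]big_mkcond; apply: eq_bigr => i _.
    by rewrite inE; case: (i \in B) => //; case: (P i).
  rewrite (cnt (fun i => 0 < h i)%R) (cnt (fun i => h i < 0)%R).
  by have := level 0 ltac:(lra); rewrite oppr0.
suff IHb : \sum_(i in B :\ i0) h' i <= D%:R * (c0 - v).
  by apply: le_trans (lerD IHb sumS) _; rewrite mulrBr [v * _]mulrC subrK.
have gt_h' c i : 0 <= c -> i \in B -> (c < h' i) = (c + v < h i).
  move=> c_ge0 iB; have := vmin i iB; rewrite /h' /s; case: (ltgtP (h i) 0) => hi /=.
  - by rewrite ltr0_norm // sub0r mulrN mulr1 opprK => vi; apply/idP/idP; lra.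
  - by rewrite gtr0_norm // subr0 mulr1 => vi; apply/idP/idP; lra.
  - by move=> _; rewrite hi subr0 mulr0 subr0; apply/idP/idP; lra.
have lt_h' c i : 0 <= c -> i \in B -> (h' i < - c) = (h i < - (c + v)).
  move=> c_ge0 iB; have := vmin i iB; rewrite /h' /s; case: (ltgtP (h i) 0) => hi /=.
  - by rewrite ltr0_norm // sub0r mulrN mulr1 opprK => vi; apply/idP/idP; lra.
  - by rewrite gtr0_norm // subr0 mulr1 => vi; apply/idP/idP; lra.
  - by move=> _; rewrite hi subr0 mulr0 subr0; apply/idP/idP; lra.
apply: IH => [||i|c cI].
- by have := cardsD1 i0 B; rewrite i0B nE => -[].
- by rewrite subr_ge0.
- by rewrite !inE => /andP[_ iB]; rewrite h'E // lerD2r hB.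
have h'0 : h' i0 = 0.
  by apply/eqP; rewrite -normr_eq0 h'E // subrr.
have -> : [set i in B :\ i0 | (c < h' i)%R] = [set i in B | (c + v < h i)%R].
  apply/setP => i; rewrite !inE; case: (boolP (i \in B)) => iB; rewrite ?andbF //= andbT.
  rewrite -gt_h' //; last lra.
  by have [->|] //= := eqVneq i i0; rewrite h'0; apply/esym/negbTE; rewrite -leNgt; lra.
have -> : [set i in B :\ i0 | (h' i < - c)%R] = [set i in B | (h i < - (c + v))%R].
  apply/setP => i; rewrite !inE; case: (boolP (i \in B)) => iB; rewrite ?andbF //= andbT.
  rewrite -lt_h' //; last lra.
  by have [->|] //= := eqVneq i i0; rewrite h'0; apply/esym/negbTE; rewrite -leNgt; lra.
by apply: level; lra.
Qed.

(* Otherwise arguments of cos and sin would be parsed in R_scope. *)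
Local Arguments cos x%_ring_scope.
Local Arguments sin x%_ring_scope.

Lemma PI_gt0 : 0 < PI :> R.
Proof. exact/RltP/PI_RGT_0. Qed.

Lemma cosN (x : R) : cos (- x) = cos x.
Proof. exact: cos_neg. Qed.

Lemma sinN (x : R) : sin (- x) = - sin x.
Proof. exact: sin_neg. Qed.

Lemma cosPI : cos PI = -1 :> R.
Proof. exact: cos_PI. Qed.

Lemma sinPI : sin PI = 0 :> R.
Proof. exact: sin_PI. Qed.

Lemma cos_abs (x : R) : cos `|x| = cos x.
Proof. by case: (ger0P x) => _ //; rewrite cosN. Qed.

Lemma cosPIB (x : R) : cos (PI - x) = - cos x.
Proof. by rewrite cosD cosN cosPI sinN sinPI; lra. Qed.

Lemma cos_le_le (x y : R) : 0 <= x -> x <= y -> y <= PI -> cos y <= cos x.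
Proof.
move=> x0 xy yp; have y0 := le_trans x0 xy; have xp := le_trans xy yp.
by apply/RleP/cos_decr_1; exact/RleP.
Qed.

Lemma cos_lt_lt (x y : R) : 0 <= x -> x < y -> y <= PI -> cos y < cos x.
Proof.
move=> x0 xy yp; have y0 := le_trans x0 (ltW xy); have xp := le_trans (ltW xy) yp.
by apply/RltP/cos_decreasing_1; first [exact/RleP|exact/RltP].
Qed.

Lemma cosPI2 : cos (PI / 2) = 0 :> R.
Proof.
by have := cosPIB (PI / 2); rewrite (_ : PI - PI / 2 = PI / 2); [lra|field].
Qed.

Lemma sin_gt0 (x : R) : 0 < x < PI -> 0 < sin x.
Proof. by case/andP=> /RltP x0 /RltP xp; apply/RltP/sin_gt_0. Qed.

Lemma sin_ge0 (x : R) : 0 <= x <= PI -> 0 <= sin x.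
Proof. by case/andP=> /RleP x0 /RleP xp; apply/RleP/sin_ge_0. Qed.

Lemma cos_le1 (x : R) : cos x <= 1.
Proof. by apply/RleP; case: (COS_bound x). Qed.

Lemma cos_surj (c : R) : 0 <= c < 1 -> exists2 x : R, 0 < x <= PI / 2 & cos x = c.
Proof.
move=> /andP[c0 c1]; have cE : cos (acos c) = c.
  by apply: cos_acos; split; apply/RleP; [change (-1 <= c)|change (c <= 1)]; lra.
have [/RleP a0 /RleP aPI] := acos_bound c; exists (acos c) => //; apply/andP; split.
  rewrite lt_neqAle a0 andbT; apply: contraTneq c1 => a0E.
  by rewrite -cE -a0E cos_0 ltxx.
rewrite leNgt; apply/negP => lta; have := PI_gt0 => pi0.
have : cos (acos c) < cos (PI / 2) by apply: cos_lt_lt => //; lra.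
by rewrite cE cosPI2; lra.
Qed.

(** Telescoping of 2 sin(d/2) cos x = sin(x + d/2) - sin(x - d/2). *)
Lemma sum_cos_AP (d y : R) (D : nat) :
  2 * sin (d / 2) * (\sum_(t < D) cos (y + t%:R * d)) =
  sin (y + D%:R * d - d / 2) - sin (y - d / 2).
Proof.
elim: D => [|D IH]; first by rewrite big_ord0 mulr0 mul0r addr0 subrr.
rewrite big_ord_recr /= mulrDr IH.
have -> : y + D.+1%:R * d - d / 2 = (y + D%:R * d) + d / 2.
  by rewrite -natr1; field.
by rewrite !sinD cosN sinN; ring.
Qed.

Lemma sum_cos_AP_le (d y : R) (D : nat) :
  0 < d / 2 < PI -> 0 <= D%:R * (d / 2) <= PI ->
  \sum_(t < D) cos (y + t%:R * d) <= sin (D%:R * (d / 2)) / sin (d / 2).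
Proof.
move=> /sin_gt0 sd /sin_ge0 sD; rewrite ler_pdivlMr //.
have := sum_cos_AP d y D.
have -> : y + D%:R * d - d / 2 = (y - d / 2 + D%:R * (d / 2)) + D%:R * (d / 2) by field.
have -> : sin (y - d / 2) = sin ((y - d / 2 + D%:R * (d / 2)) - D%:R * (d / 2)).
  by congr sin; ring.
move: (D%:R * (d / 2)) sD => b sb; move: (y - d / 2 + b) => u; rewrite !sinD cosN sinN.
have := cos_le1 u; move: (cos u) (sin b) sb => cu s_b sb cu1 E; nra.
Qed.

Lemma int_floor (x : R) : exists m : int, m%:~R <= x < m%:~R + 1.
Proof. by exists (Num.floor x); have := floor_itv x; rewrite rmorphD. Qed.
Arguments int_floor x%_ring_scope.

Lemma card_set_in (T : finType) (B : {set T}) (P : pred T) :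
  #|[set i in B | P i]| = (\sum_(i in B) P i)%N.
Proof.
rewrite -sum1_card [LHS]big_mkcond [RHS]big_mkcond; apply: eq_bigr => i _.
by rewrite inE; case: (i \in B) => //; case: (P i).
Qed.

(* The two windows run from the lower end a of the cone |x| < y upwards and
   from its upper end b downwards; they overlap in the cone and miss nothing
   but the opposite cone. *)
Lemma cone_count (p q D : nat) (phi y : R) (B : {set 'I_p}) :
  p = q.*2.+1 ->
  (forall a b : int,
     (#|[set i in B | (a <= (i : nat)%:Z - q%:Z <= a + q%:Z)%R]| +
      #|[set i in B | (b - q%:Z <= (i : nat)%:Z - q%:Z <= b)%R]| <= #|B| + D)%N) ->
  1 / 2 < y -> 2 * y <= q%:R + 1 / 2 ->
  (#|[set i in B | (`|(i : nat)%:R - q%:R - phi| < y)%R]| <=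
   #|[set i in B | (q%:R + 1 / 2 - y < `|(i : nat)%:R - q%:R - phi|)%R]| + D)%N.
Proof.
move=> pE win y1 yq.
have [m /andP[m1 m2]] := int_floor (phi - y); have [m' /andP[m1' m2']] := int_floor (- (phi + y)).
have := win (m + 1) (- (m' + 1)); rewrite !card_set_in -sum1_card => W.
rewrite -(leq_add2r (\sum_(i in B) 1)) -addnA [(D + _)%N]addnC.
apply: leq_trans (leq_add (leqnn _) W); rewrite -!big_split /=; apply: leq_sum => i _.
have ltI (u v : int) : u < v -> u%:~R + 1 <= v%:~R :> R.
  by move=> uv; rewrite -[1]/(1%:~R) -rmorphD ler_int; lia.
have kR : (i : nat)%:R - q%:R = ((i : nat)%:Z - q%:Z)%:~R :> R by rewrite rmorphB /= !pmulrn.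
move: (_ - q%:Z) kR => k ->; have qR : q%:R = q%:Z%:~R :> R by rewrite pmulrn.
have nq : 0 <= q%:R :> R by apply: ler0n.
case: (boolP (_ < y)) => [/[!ltr_norml] /andP[k1 k2]|_].
  have -> : m + 1 <= k <= m + 1 + q%:Z.
    apply/andP; split; rewrite leNgt; apply/negP => /ltI; rewrite ?rmorphD /= -?qR; lra.
  have -> : - (m' + 1) - q%:Z <= k <= - (m' + 1).
    apply/andP; split; rewrite leNgt; apply/negP => /ltI; rewrite ?rmorphB ?rmorphN ?rmorphD /= -?qR; lra.
  exact: leq_addl.
case: (boolP (m + 1 <= k <= m + 1 + q%:Z)) => kA; first by rewrite addnCA; exact: leq_addr.
case: (boolP (- (m' + 1) - q%:Z <= k <= - (m' + 1))) => kB; first by rewrite addnA; exact: leq_addl.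
suff -> : q%:R + 1 / 2 - y < `|k%:~R - phi| by [].
rewrite ltr_normr.
have [kq|kq] := ltrP (m + 1 + q%:Z) k.
  by apply/orP; left; move: kq => /ltI; rewrite !rmorphD /= -?qR; lra.
have kb : k < - (m' + 1) - q%:Z.
  have ab : m + 1 <= - (m' + 1).
    by rewrite leNgt; apply/negP => /ltI; rewrite rmorphN !rmorphD /=; lra.
  lia.
by apply/orP; right; move: kb => /ltI; rewrite rmorphB rmorphN !rmorphD /= -?qR; lra.
Qed.

Lemma sum_window (F : nmodType) (p M D : nat) (f : nat -> F) :
  (M + D <= p)%N ->
  \sum_(i < p) (if (M <= i < M + D)%N then f i else 0) = \sum_(t < D) f (M + t)%N.
Proof.
move=> MDp; rewrite -(big_mkord xpredT (fun i => if (M <= i < M + D)%N then f i else 0)).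
rewrite (@big_cat_nat _ _ _ M) //=; last by apply: leq_trans MDp; apply: leq_addr.
rewrite [X in _ + X](@big_cat_nat _ _ _ (M + D)) ?leq_addr //=.
rewrite [X in X + _]big1_seq ?add0r; last first.
  by move=> i; rewrite mem_index_iota => iM; rewrite (_ : (M <= i < M + D)%N = false) //; lia.
rewrite [X in _ + X]big1_seq ?addr0; last first.
  by move=> i; rewrite mem_index_iota => iM; rewrite (_ : (M <= i < M + D)%N = false) //; lia.
rewrite -{1}[M]add0n [(M + D)%N]addnC big_addn addnK big_mkord.
apply: eq_bigr => i _; have := ltn_ord i; rewrite [(i + M)%N]addnC => iD.
by rewrite (_ : (M <= M + i < D + M)%N = true) //; lia.
Qed.

(** The right-hand side is the modulus of a sum of D consecutive p-th roots of unity. The cosine g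
    is clipped at c0 = cos(pi D/p). The clipped h sums to at most D c0 by [layer_bound], whose
    levels are the cones of [cone_count]. The excess g - h lives within D/2 steps of the direction
    phi, so it is at most the sum of g - c0 over D consecutive positions; the terms D c0 cancel. *)
Lemma arc_bound (p q D : nat) (phi : R) (B : {set 'I_p}) :
  p = q.*2.+1 -> (1 < q)%N -> (0 < D)%N -> (D.*2 <= p)%N -> `|phi| <= 1 / 2 ->
  (forall a b : int,
     (#|[set i in B | (a <= (i : nat)%:Z - q%:Z <= a + q%:Z)%R]| +
      #|[set i in B | (b - q%:Z <= (i : nat)%:Z - q%:Z <= b)%R]| <= #|B| + D)%N) ->
  \sum_(i in B) cos (2 * PI / p%:R * ((i : nat)%:R - q%:R - phi)) <=
  sin (D%:R * (PI / p%:R)) / sin (PI / p%:R).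
Proof.
move=> pE q1 D0 Dp phiI win.
have pR : p%:R = 2 * q%:R + 1 :> R by rewrite pE -natr1 -mul2n natrM.
have q2R : 2 <= q%:R :> R by rewrite ler_nat.
have D1R : 1 <= D%:R :> R by rewrite ler1n.
have DpR : 2 * D%:R <= p%:R :> R by rewrite -natrM ler_nat mul2n.
have [d dE] : exists d : R, d = 2 * PI / p%:R by exists (2 * PI / p%:R).
have pi0 := PI_gt0.
have p0 : p%:R != 0 :> R by rewrite pR gt_eqF //; lra.
have p_gt0 : 0 < p%:R :> R by rewrite pR; lra.
have d0 : 0 < d by rewrite dE; apply: divr_gt0 => //; apply: mulr_gt0 => //; lra.
have dpi : d * (q%:R + 1 / 2) = PI.
  by rewrite dE; apply: (mulIf p0); rewrite mulrAC mulfVK // pR; field.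
rewrite -dE.
have [x xE] : exists x : 'I_p -> R, forall i, x i = (i : nat)%:R - q%:R - phi by eexists.
have [g gE] : exists g : 'I_p -> R, forall i, g i = cos (d * x i) by eexists.
under eq_bigr => i _ do rewrite -xE -gE.
have /andP[phi1 phi2] : - (1 / 2) <= phi <= 1 / 2 by rewrite -ler_norml.
have xI i : `|x i| <= q%:R + 1 / 2.
  have : (i : nat)%:R <= 2 * q%:R :> R.
    by rewrite -natrM ler_nat; have := ltn_ord i; rewrite [X in (_ < X)%N -> _]pE ltnS mul2n.
  have : 0 <= (i : nat)%:R :> R by apply: ler0n.
  by rewrite xE ler_norml => i1 i2; apply/andP; split; lra.
have gabs i : g i = cos (d * `|x i|) by rewrite gE -cos_abs normrM (gtr0_norm d0).
have dI (y : R) : 0 <= y -> y <= q%:R + 1 / 2 -> 0 <= d * y <= PI.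
  by move=> y0 yq; rewrite mulr_ge0 ?(ltW d0) //= -dpi ler_pM2l.
have gle i (y : R) : 0 <= y -> y <= `|x i| -> g i <= cos (d * y).
  move=> y0 yx; rewrite gabs; apply: cos_le_le; rewrite ?mulr_ge0 ?(ltW d0) ?ler_pM2l //.
  by have /andP[] := dI _ (normr_ge0 (x i)) (xI i).
have gge i (y : R) : `|x i| <= y -> y <= q%:R + 1 / 2 -> cos (d * y) <= g i.
  move=> yx yq; rewrite gabs; apply: cos_le_le; rewrite ?mulr_ge0 ?(ltW d0) ?ler_pM2l //.
  by rewrite -dpi ler_pM2l.
have [c0 c0E] : exists c0 : R, c0 = cos (d * (D%:R / 2)) by eexists.
have c0_ge0 : 0 <= c0.
  rewrite c0E -cosPI2; apply: cos_le_le; rewrite ?mulr_ge0 ?(ltW d0) //; [lra| |lra].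
  by rewrite -dpi mulrAC -mulrA ler_pM2l //; lra.
have [h hE] : exists h : 'I_p -> R, forall i,
  h i = if c0 < g i then c0 else if g i < - c0 then - c0 else g i by eexists.
have sum_h : \sum_(i in B) h i <= D%:R * c0.
  apply: layer_bound => // [i _|c /andP[c_ge0 cc0]].
    by rewrite hE ler_norml; case: (ltrP c0 (g i)) => g1; [|case: (ltrP (g i) (- c0)) => g2]; lra.
  have [t /andP[t0 tpi] tc] : exists2 t : R, 0 < t <= PI / 2 & cos t = c.
    by apply: cos_surj; rewrite c_ge0 (lt_le_trans cc0) // c0E cos_le1.
  have [y yE] : exists y : R, t = d * y by exists (t / d); rewrite mulrC divfK // gt_eqF.
  have y_ge0 : 0 < y by rewrite -(pmulr_rgt0 _ d0) -yE.
  have yq : 2 * y <= q%:R + 1 / 2.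
    by rewrite -(ler_pM2l d0) dpi mulrCA -yE; lra.
  have yD : D%:R / 2 < y.
    rewrite ltNge; apply/negP => yD; move: cc0; rewrite -tc yE c0E ltNge => /negP; apply.
    apply: cos_le_le; rewrite ?ler_pM2l ?mulr_ge0 ?(ltW d0) ?(ltW y_ge0) //.
    by rewrite -dpi ler_pM2l //; lra.
  have := @cone_count p q D phi y B pE win ltac:(lra) yq => cone.
  apply: (leq_trans _ (leq_trans cone _)); rewrite ?leq_add2r; apply/subset_leq_card/subsetP => i.
    rewrite !inE -xE => /andP[-> /=]; rewrite hE ltNge => ch; rewrite ltNge; apply: contra ch => yx.
    have := gle i y (ltW y_ge0) yx; rewrite -yE tc.
    by case: (ltrP c0 (g i)) => g1; [|case: (ltrP (g i) (- c0)) => g2] => g3; clear -g1 g3 cc0 c_ge0 c0_ge0; lra.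
  rewrite !inE -xE => /andP[-> /=] yx; rewrite hE.
  suff : g i < - c.
    case: (ltrP c0 (g i)) => g1; [|case: (ltrP (g i) (- c0)) => g2] => g3.
    - by clear -g1 g3 c_ge0 c0_ge0; lra.
    - by clear -cc0; lra.
    - by [].
  rewrite -tc yE -cosPIB -dpi -mulrBr gabs; apply: cos_lt_lt.
  - by apply: mulr_ge0; lra.
  - by rewrite ltr_pM2l.
  - by have /andP[] := dI _ (normr_ge0 (x i)) (xI i).
(* M = q - m' is the first of the D indices i with -D/2 <= i - q - phi < D/2. *)
have [m' /andP[m1 m2]] := int_floor (D%:R / 2 - phi).
have qm : 0 <= q%:Z - m'.
  by rewrite -ltzD1 -(ltr_int R) rmorphD rmorphB /= -!pmulrn; lra.
have [M ME] := nat_of_ge0 qm.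
have MR : M%:R = q%:R - m'%:~R :> R by rewrite pmulrn ME rmorphB /= -pmulrn.
have MDp : (M + D <= p)%N.
  have : (M + D < p.+1)%N by rewrite -(ltr_nat R) natrD -natr1 MR; lra.
  by [].
pose F (i : nat) : R := cos (d * (i%:R - q%:R - phi)) - c0.
have FE (i : 'I_p) : F i = g i - c0 by rewrite /F gE xE.
pose e (i : nat) : R := if (M <= i < M + D)%N then F i else 0.
have eI (i : 'I_p) : 0 <= e i /\ g i - h i <= e i.
  rewrite /e; case: ifP => [/andP[Mi iD]|iN].
    have Mi' : M%:R <= (i : nat)%:R :> R by rewrite ler_nat.
    have iD' : (i : nat)%:R + 1 <= M%:R + D%:R :> R by rewrite natr1 -natrD ler_nat.
    have : c0 <= g i.
      by rewrite c0E; apply: gge; [rewrite xE ler_norml; apply/andP; split|]; lra.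
    rewrite FE hE => g0; split; first lra.
    case: (ltrP c0 (g i)) => g1; [|case: (ltrP (g i) (- c0)) => g2].
    + by clear; lra.
    + by clear -g0 g2 c0_ge0; lra.
    + by clear -g0; lra.
  have : g i <= c0.
    rewrite c0E; apply: gle; first lra.
    rewrite xE ler_normr; move/negbT: iN; rewrite negb_and -!ltnNge => /orP[iM|iM].
      have iM' : (i : nat)%:R + 1 <= M%:R :> R by rewrite natr1 ler_nat.
      by apply/orP; right; lra.
    have iM' : M%:R + D%:R <= (i : nat)%:R :> R by rewrite -natrD ler_nat -ltnS.
    by apply/orP; left; lra.
  rewrite hE => g0; split=> //; case: (ltrP c0 (g i)) => g1; [|case: (ltrP (g i) (- c0)) => g2].
  - by clear -g0 g1; lra.
  - by clear -g2; lra.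
  - by clear; lra.
have sum_e : \sum_(i in B) (g i - h i) <= \sum_(t < D) F (M + t)%N.
  rewrite -(sum_window _ MDp); apply: (@le_trans _ _ (\sum_(i in B) e i)).
    by apply: ler_sum => i _; have [] := eI i.
  rewrite big_mkcond /=; apply: ler_sum => i _; have [] := eI i.
  by case: (i \in B).
have := @sum_cos_AP_le d (d * (M%:R - q%:R - phi)) D.
have dp : d / 2 = PI / p%:R by rewrite dE; field.
rewrite dp => cos_sum.
have -> : \sum_(i in B) g i = \sum_(i in B) h i + \sum_(i in B) (g i - h i).
  by rewrite -big_split /=; apply: eq_bigr => i _; rewrite subrKC.
apply: le_trans (lerD sum_h sum_e) _.
rewrite (_ : _ + _ = \sum_(t < D) cos (d * (M%:R - q%:R - phi) + t%:R * d)).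
  have pi_p : PI / p%:R <= PI / 2.
    by rewrite ler_pM2l // lef_pV2 ?posrE //; lra.
  have pi_p0 : 0 < PI / p%:R by apply: divr_gt0.
  apply: cos_sum; first by apply/andP; split => //; lra.
  apply/andP; split; first by apply: mulr_ge0; lra.
  rewrite mulrCA -[leRHS]mulr1 ler_pM2l // ler_pdivrMr // mul1r; lra.
rewrite [X in _ + X](eq_bigr (fun t : 'I_D => cos (d * (M%:R - q%:R - phi) + t%:R * d) + - c0)).
  by rewrite big_split /= sumr_const card_ord -[(- c0) *+ D]mulr_natl mulrN [LHS]addrCA subrr addr0.
by move=> t _; rewrite /F natrD; congr (cos _ - _); ring.
Qed.

Lemma cosD2PI (x : R) (m : int) : cos (x + 2 * PI * m%:~R) = cos x.
Proof.
have nat_case (y : R) (n : nat) : cos (y + 2 * PI * n%:R) = cos y.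
  rewrite -[RHS](cos_period y n) INRE; congr cos.
  by change (y + 2 * PI * n%:R = y + 2%:R * n%:R * PI); ring.
case: m => n; first by rewrite -pmulrn nat_case.
rewrite NegzE rmorphN /= -pmulrn -[LHS](nat_case _ n.+1); congr cos; ring.
Qed.

Lemma Zp_intr (p : nat) (z : 'Z_p) (t : int) :
  prime p -> z = t%:~R -> exists m : int, (z : nat)%:Z = t + m * p%:Z.
Proof.
move=> p_pr zE; have /dvdzP[m mE] : (p %| (z : nat)%:Z - t)%Z.
  by rewrite -intr_Zp_eq0 // rmorphB /= -pmulrn natr_Zp zE subrr.
by exists m; rewrite -mE addrC subrK.
Qed.

(** For p = 2q + 1 these q + 1 residues form a half-circle, short enough (2q < p) for sums of two of
    them to behave as in the integers. *)
Definition window (p : nat) (B : {set 'Z_p}) (q : nat) (j : 'Z_p) : nat :=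
  #|[set t : 'I_q.+1 | j + (t : nat)%:R \in B]|.

(** Measured in steps of 2 pi/p, [th] is a nearest integer k0 plus a fraction phi with |phi| <= 1/2;
    k0 is absorbed by rotating the indices, which leaves [arc_bound]. *)
Lemma Zp_cos_bound (p q D : nat) (B : {set 'Z_p}) (th : R) :
  prime p -> p = q.*2.+1 -> (1 < q)%N -> (0 < D)%N -> (D.*2 <= p)%N ->
  (forall j j' : 'Z_p, (window B q j + window B q j' <= #|B| + D)%N) ->
  \sum_(z in B) cos (2 * PI / p%:R * (z : nat)%:R - th) <=
  sin (D%:R * (PI / p%:R)) / sin (PI / p%:R).
Proof.
move=> p_pr pE q1 D0 Dp win; have p1 := prime_gt1 p_pr.
have p_neq0 : p%:R != 0 :> R by rewrite pnatr_eq0; case: (p) p1.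
have d_neq0 : 2 * PI / p%:R != 0 :> R.
  by rewrite mulf_neq0 ?invr_neq0 // mulf_neq0 ?pnatr_eq0 ?gt_eqF ?PI_gt0.
have [k0 /andP[k1 k2]] := int_floor (th / (2 * PI / p%:R) + 1 / 2).
have [phi phiE] : exists phi : R, phi = th / (2 * PI / p%:R) - k0%:~R by eexists.
have thE : th = 2 * PI / p%:R * (k0%:~R + phi).
  by rewrite phiE addrC subrK mulrC divfK.
pose f (i : 'I_p) : 'Z_p := (k0 - q%:Z + (i : nat)%:Z)%:~R.
have f_inj : injective f.
  move=> i i' /eqP; rewrite -subr_eq0 -rmorphB intr_Zp_eq0 // => /dvdzP[m mE].
  apply/val_inj => /=; have := ltn_ord i; have := ltn_ord i'.
  move: (nat_of_ord i) (nat_of_ord i') mE => u v mE vp up.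
  by have : m = 0 by [nia]; move=> m0; move: mE; rewrite m0; lia.
have f_bij : bijective f by apply: inj_card_bij => //; rewrite card_Zp_prime ?card_ord.
rewrite (reindex f) /=; last exact: onW_bij.
rewrite (eq_bigl (fun i => i \in [set i | f i \in B])); last by move=> i; rewrite inE.
rewrite (eq_bigr (fun i : 'I_p => cos (2 * PI / p%:R * ((i : nat)%:R - q%:R - phi)))); last first.
  move=> i _; have [m mE] := @Zp_intr p (f i) _ p_pr erefl.
  rewrite [X in _ * X](_ : _ = (k0%:~R - q%:R + (i : nat)%:R) + m%:~R * p%:R); last first.
    by rewrite [LHS]pmulrn mE rmorphD rmorphM rmorphD rmorphB /= -!pmulrn.
  rewrite -[RHS](cosD2PI _ m) thE; congr cos.
  by field.
have cB : #|[set i | f i \in B]| = #|B|.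
  rewrite -(card_imset _ f_inj); apply: eq_card => z; apply/imsetP/idP => [[i]|zB].
    by rewrite inE => ? ->.
  by have [g _ gK] := f_bij; exists (g z); rewrite ?inE gK.
have win_le (a : int) :
  (#|[set i in [set i | f i \in B] | (a <= (i : nat)%:Z - q%:Z <= a + q%:Z)%R]|
    <= window B q (k0 + a)%:~R)%N.
  rewrite /window.
  pose t (i : 'I_p) : 'I_q.+1 := inord (absz ((i : nat)%:Z - q%:Z - a)%R).
  rewrite -(@card_in_imset _ _ t); last first.
    move=> i i'; rewrite !inE => /andP[_ iI] /andP[_ iI'] /(congr1 val).
    by rewrite /= !inordK => [tE||]; [apply/val_inj => /=|..]; lia.
  apply/subset_leq_card/subsetP => z /imsetP[i]; rewrite !inE => /andP[fB iI] ->.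
  rewrite inordK; last lia.
  rewrite pmulrn -rmorphD; move: fB; rewrite /f; congr (_%:~R \in B); lia.
apply: arc_bound => // [|a b].
  by rewrite ler_norml phiE; apply/andP; split; lra.
rewrite cB; apply: leq_trans (win (k0 + a)%:~R (k0 + (b - q%:Z))%:~R).
have := win_le (b - q%:Z); rewrite subrK => win_b; exact: leq_add (win_le a) win_b.
Qed.

(** * Fourier coefficients *)

Lemma cos2Dsin2 (x : R) : cos x * cos x + sin x * sin x = 1.
Proof. by rewrite -[RHS](sin2_cos2 x) addrC. Qed.

Lemma sinD2PI (x : R) (m : int) : sin (x + 2 * PI * m%:~R) = sin x.
Proof.
have cos1 : cos (2 * PI * m%:~R) = 1.
  by rewrite -[X in cos X]add0r cosD2PI; apply: cos_0.
have := cos2Dsin2 (2 * PI * m%:~R); rewrite cos1 sinD cos1 => E.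
have /eqP : sin (2 * PI * m%:~R) ^+ 2 = 0 by rewrite expr2; lra.
by rewrite sqrf_eq0 => /eqP ->; rewrite mulr0 mulr1 addr0.
Qed.

(** For th the direction of (x, y), the projection is the norm; this turns the modulus of a Fourier
    coefficient into a single sum of cosines. *)
Lemma polar_angle (x y : R) :
  exists th : R, 0 <= x * cos th + y * sin th /\
    (x * cos th + y * sin th) ^+ 2 = x ^+ 2 + y ^+ 2.
Proof.
have [r rE] : exists r : R, r = Num.sqrt (x ^+ 2 + y ^+ 2) by eexists.
have sq_ge0 : 0 <= x ^+ 2 + y ^+ 2 by rewrite addr_ge0 ?sqr_ge0.
have r2 : r ^+ 2 = x ^+ 2 + y ^+ 2 by rewrite rE sqr_sqrtr.
have r_ge0 : 0 <= r by rewrite rE sqrtr_ge0.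
have [r0|r_neq0] := eqVneq r 0.
  exists 0; have /eqP : x ^+ 2 + y ^+ 2 = 0 by rewrite -r2 r0 expr0n.
  by rewrite paddr_eq0 ?sqr_ge0 // !sqrf_eq0 => /andP[/eqP -> /eqP ->];
    rewrite !mul0r addr0; split => //; rewrite expr0n /= addr0.
have r_gt0 : 0 < r by rewrite lt_neqAle eq_sym r_neq0.
have xr : - r <= x <= r.
  by rewrite -ler_norml -(ler_sqr (normr_ge0 x) r_ge0) real_normK ?num_real // r2 lerDl sqr_ge0.
have cE : cos (acos (x / r)) = x / r.
  apply: cos_acos; split; apply/RleP; [change (-1 <= x / r)|change (x / r <= 1)].
    by rewrite ler_pdivlMr // mulN1r; case/andP: xr.
  by rewrite ler_pdivrMr // mul1r; case/andP: xr.
have [/RleP a0 /RleP aPI] := acos_bound (x / r).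
have s_ge0 : 0 <= sin (acos (x / r)) by apply: sin_ge0; apply/andP.
have sE : sin (acos (x / r)) = `|y| / r.
  apply/eqP; rewrite -(@eqrXn2 _ 2) ?divr_ge0 //.
  have := cos2Dsin2 (acos (x / r)); rewrite cE => E.
  have -> : sin (acos (x / r)) ^+ 2 = 1 - (x / r) ^+ 2 by rewrite -E; ring.
  rewrite !expr_div_n real_normK ?num_real // r2; apply/eqP.
  by rewrite -r2; apply: (mulIf (expf_neq0 2 r_neq0)); rewrite mulrBl !divfK ?expf_neq0 // mul1r r2; ring.
suff [th thE] : exists th : R, x * cos th + y * sin th = r.
  by exists th; rewrite thE.
have E : x * (x / r) + y * (y / r) = r.
  by apply: (mulIf r_neq0); rewrite -[r * r]expr2 r2; field.
have [y0|y0] := ger0P y.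
  by exists (acos (x / r)); rewrite cE sE ger0_norm.
by exists (- acos (x / r)); rewrite cosN sinN cE sE ltr0_norm // mulNr opprK.
Qed.

Lemma sum_cosD (I : finType) (X : {set I}) (v : R) (u : I -> R) :
  \sum_(i in X) cos (v + u i) =
  cos v * (\sum_(i in X) cos (u i)) - sin v * (\sum_(i in X) sin (u i)).
Proof. by rewrite !mulr_sumr -sumrB; apply: eq_bigr => i _; rewrite cosD. Qed.

Lemma sum_sinD (I : finType) (X : {set I}) (v : R) (u : I -> R) :
  \sum_(i in X) sin (v + u i) =
  sin v * (\sum_(i in X) cos (u i)) + cos v * (\sum_(i in X) sin (u i)).
Proof. by rewrite !mulr_sumr -big_split; apply: eq_bigr => i _; rewrite sinD. Qed.

Lemma sum_cosB (I : finType) (X : {set I}) (v : R) (u : I -> R) :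
  \sum_(i in X) cos (v - u i) =
  cos v * (\sum_(i in X) cos (u i)) + sin v * (\sum_(i in X) sin (u i)).
Proof.
rewrite sum_cosD; under eq_bigr do rewrite cosN.
by under [X in _ - _ * X]eq_bigr do rewrite sinN; rewrite sumrN mulrN opprK.
Qed.

Lemma sum_cos_square (I : finType) (X : {set I}) (u : I -> R) :
  \sum_(i in X) \sum_(j in X) cos (u i - u j) =
  (\sum_(i in X) cos (u i)) ^+ 2 + (\sum_(i in X) sin (u i)) ^+ 2.
Proof.
by under eq_bigr do rewrite sum_cosB; rewrite big_split /= -!mulr_suml !expr2.
Qed.

(** The real part of (C + iS)^2 (C' - iS'), where C' and S' are the two sums over [Y]. *)
Lemma sum_cos_triple (I J : finType) (X : {set I}) (Y : {set J}) (u : I -> R) (w : J -> R) :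
  let C := \sum_(i in X) cos (u i) in let S := \sum_(i in X) sin (u i) in
  \sum_(i in X) \sum_(j in X) \sum_(k in Y) cos (u i + u j - w k) =
  (C ^+ 2 - S ^+ 2) * (\sum_(k in Y) cos (w k)) + 2 * C * S * (\sum_(k in Y) sin (w k)).
Proof.
move=> C S; set C' := \sum_(k in Y) cos _; set S' := \sum_(k in Y) sin _.
transitivity (\sum_(i in X) ((cos (u i) * C - sin (u i) * S) * C' +
    (sin (u i) * C + cos (u i) * S) * S')).
  apply: eq_bigr => i _; under eq_bigr do rewrite sum_cosB.
  by rewrite big_split /= -!mulr_suml sum_cosD sum_sinD.
rewrite big_split /= -!mulr_suml sumrB big_split /= -!mulr_suml -/C -/S; ring.
Qed.

(** Orthogonality of characters. For a nonzero residue, [sum_cos_AP] over whole turns gives 0 on the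
    right, while the factor sin(h/2) is positive. *)
Lemma sum_cos_orth (p : nat) (t : int) : prime p ->
  \sum_(k < p) cos (2 * PI / p%:R * (k : nat)%:R * t%:~R) =
  if t%:~R == 0 :> 'Z_p then p%:R else 0.
Proof.
move=> p_pr; have p0 : 0 < p%:R :> R by rewrite ltr0n prime_gt0.
have p_neq0 : p%:R != 0 :> R by rewrite gt_eqF.
have [m mE] := @Zp_intr p _ t p_pr erefl.
have tE : t%:~R = (nat_of_ord (t%:~R : 'Z_p))%:R - m%:~R * p%:R :> R.
  by rewrite [X in _ = X - _]pmulrn mE rmorphD rmorphM /= -pmulrn addrK.
have redE (k : nat) : cos (2 * PI / p%:R * k%:R * t%:~R) =
    cos (0 + k%:R * (2 * PI / p%:R * (nat_of_ord (t%:~R : 'Z_p))%:R)).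
  rewrite -[RHS](cosD2PI _ (- (k%:Z * m))) tE; congr cos.
  by rewrite rmorphN rmorphM /= -pmulrn; field.
under eq_bigr do rewrite redE; move: (t%:~R) => z {mE tE redE}.
have [->|z0] := eqVneq z 0.
  under eq_bigr => k _ do rewrite mulr0 mulr0 addr0 (_ : cos 0 = 1 :> R) ?cos_0 //.
  by rewrite sumr_const card_ord.
have zp : (nat_of_ord z < p)%N.
  by have := ltn_ord z; rewrite [X in (_ < X)%N -> _](Zp_cast (prime_gt1 p_pr)).
have z_gt0 : (0 < nat_of_ord z)%N by rewrite lt0n; apply: contraNneq z0 => ?; apply/eqP/val_inj.
have := sum_cos_AP (2 * PI / p%:R * (nat_of_ord z)%:R) 0 p; set h := 2 * PI / p%:R * _.
have h2 : 0 < h / 2 < PI.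
  have -> : h / 2 = PI * ((nat_of_ord z)%:R / p%:R) by rewrite /h; field.
  have zR : 0 < (nat_of_ord z)%:R :> R by rewrite ltr0n.
  apply/andP; split; first by apply: mulr_gt0; [exact: PI_gt0|exact: divr_gt0].
  by rewrite -[ltRHS]mulr1 ltr_pM2l ?PI_gt0 // ltr_pdivrMr // mul1r ltr_nat.
have -> : sin (0 + p%:R * h - h / 2) = sin (0 - h / 2).
  rewrite -[RHS](sinD2PI _ (nat_of_ord z)%:Z); congr sin.
  by rewrite -pmulrn /h; field.
rewrite subrr => /eqP; rewrite mulf_eq0 => /orP[|/eqP //].
by rewrite gt_eqF // mulr_gt0 ?sin_gt0.
Qed.

Definition angle (p : nat) (k : nat) (x : 'Z_p) :=
  2 * PI / p%:R * k%:R * (nat_of_ord x)%:R.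

(** With [sin_sum], the real and imaginary parts of a Fourier coefficient of the indicator of
    [X]. *)
Definition cos_sum (p : nat) (X : {set 'Z_p}) (k : nat) := \sum_(x in X) cos (angle k x).
Definition sin_sum (p : nat) (X : {set 'Z_p}) (k : nat) := \sum_(x in X) sin (angle k x).

Lemma parseval (p : nat) (X : {set 'Z_p}) : prime p ->
  \sum_(k < p) (cos_sum X k ^+ 2 + sin_sum X k ^+ 2) = p%:R * #|X|%:R.
Proof.
move=> p_pr; under eq_bigr => k _ do rewrite -sum_cos_square.
rewrite exchange_big /= (eq_bigr (fun=> p%:R)) => [|x xX].
  by rewrite sumr_const mulr_natr.
rewrite exchange_big /= (bigD1 x) //= [X in _ + X]big1 ?addr0 => [|y /andP[_ yx]].
  under eq_bigr => k _ do rewrite subrr (_ : cos 0 = 1 :> R) ?cos_0 //.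
  by rewrite sumr_const card_ord.
rewrite (eq_bigr (fun k : 'I_p => cos (2 * PI / p%:R * (k : nat)%:R *
    ((nat_of_ord x)%:Z - (nat_of_ord y)%:Z)%:~R))) => [|k _].
  by rewrite sum_cos_orth // rmorphB /= -!pmulrn !natr_Zp subr_eq0 eq_sym (negPf yx).
by rewrite rmorphB /= -!pmulrn mulrBr.
Qed.

(** By orthogonality the left side is p times the number of solutions of x + y = z, and each pair
    (x, y) has exactly one z in the sumset. *)
Lemma triple_sum (p : nat) (A : {set 'Z_p}) : prime p ->
  let S := sumset A A in
  \sum_(k < p) ((cos_sum A k ^+ 2 - sin_sum A k ^+ 2) * cos_sum S k +
    2 * cos_sum A k * sin_sum A k * sin_sum S k) = p%:R * #|A|%:R ^+ 2.
Proof.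
move=> p_pr S; under eq_bigr => k _ do rewrite -sum_cos_triple.
rewrite exchange_big /= (eq_bigr (fun=> p%:R * #|A|%:R)) => [|x xA].
  by rewrite sumr_const -[LHS]mulr_natr expr2 mulrA.
rewrite exchange_big /= (eq_bigr (fun=> p%:R)) => [|y yA].
  by rewrite sumr_const mulr_natr.
have zE z : \sum_(k < p) cos (angle k x + angle k y - angle k z) =
    if x + y == z then p%:R else 0.
  rewrite (eq_bigr (fun k : 'I_p => cos (2 * PI / p%:R * (k : nat)%:R *
      ((nat_of_ord x)%:Z + (nat_of_ord y)%:Z - (nat_of_ord z)%:Z)%:~R))) => [|k _].
    by rewrite sum_cos_orth // rmorphB rmorphD /= -!pmulrn !natr_Zp subr_eq0.
  by rewrite rmorphB rmorphD /= -!pmulrn mulrBr mulrDr.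
rewrite exchange_big /=; under eq_bigr => z _ do rewrite zE.
rewrite (bigD1 (x + y)) /= ?eqxx; last by apply/imset2P; exists x y.
by rewrite big1 ?addr0 // => z /andP[_]; rewrite eq_sym => /negPf ->.
Qed.

(** For complex numbers f, f' with |f| <= K: Re(f^2 conj f') <= K |f| |f'| <= K/2 (|f|^2 + |f'|^2).
    The square subtracted in [CS] is that of the imaginary part. *)
Lemma triple_term_le (K c s c' s' : R) :
  0 <= K -> c ^+ 2 + s ^+ 2 <= K ^+ 2 ->
  (c ^+ 2 - s ^+ 2) * c' + 2 * c * s * s' <=
  K / 2 * ((c ^+ 2 + s ^+ 2) + (c' ^+ 2 + s' ^+ 2)).
Proof.
move=> K0 cK; set T := _ + 2 * c * s * s'.
have r0 : 0 <= c ^+ 2 + s ^+ 2 by rewrite addr_ge0 ?sqr_ge0.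
have r0' : 0 <= c' ^+ 2 + s' ^+ 2 by rewrite addr_ge0 ?sqr_ge0.
have CS : T ^+ 2 <= (c ^+ 2 + s ^+ 2) ^+ 2 * (c' ^+ 2 + s' ^+ 2).
  rewrite -subr_ge0; have -> : (c ^+ 2 + s ^+ 2) ^+ 2 * (c' ^+ 2 + s' ^+ 2) - T ^+ 2 =
    ((c ^+ 2 - s ^+ 2) * s' - 2 * c * s * c') ^+ 2 by rewrite /T; ring.
  exact: sqr_ge0.
move: (c ^+ 2 + s ^+ 2) (c' ^+ 2 + s' ^+ 2) r0 r0' cK CS => u u' u0 u0' uK CS.
have rhs0 : 0 <= K / 2 * (u + u') by rewrite mulr_ge0 ?divr_ge0 ?addr_ge0.
apply: le_trans (ler_norm _) _; rewrite -ler_sqr ?nnegrE ?normr_ge0 //.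
rewrite real_normK ?num_real //; apply: le_trans CS _.
have h1 : u ^+ 2 * u' <= K ^+ 2 * u * u'.
  by rewrite expr2 ler_wpM2r // ler_wpM2r.
apply: le_trans h1 _; rewrite -subr_ge0.
have -> : (K / 2 * (u + u')) ^+ 2 - K ^+ 2 * u * u' = (K / 2 * (u - u')) ^+ 2 by field.
exact: sqr_ge0.
Qed.

(** With N = |A| and s = |2A|, frequency 0 contributes N^2 s to [triple_sum]. By Parseval the other
    frequencies carry N(p - N) and s(p - s), both at most s(p - s) as N <= s <= p - N. Hence N^2 (p
    - s) <= K s (p - s). *)
Lemma large_coefficient (p : nat) (A : {set 'Z_p}) (K : R) :
  prime p -> 0 <= K -> (#|sumset A A| + #|A| <= p)%N -> (#|sumset A A| < p)%N ->
  (forall k : nat, (0 < k < p)%N -> cos_sum A k ^+ 2 + sin_sum A k ^+ 2 <= K ^+ 2) ->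
  #|A|%:R ^+ 2 <= K * #|sumset A A|%:R.
Proof.
move=> p_pr; have := prime_gt0 p_pr; case: p A p_pr => // p A p_pr _ K0.
set S := sumset A A => pub Sp bound.
have NS : (#|A| <= #|S|)%N by exact: card_sumset_ge.
have := triple_sum A p_pr; rewrite -/S /=; move: (parseval A p_pr) (parseval S p_pr).
have angle0 (x : 'Z_p.+1) : angle 0 x = 0 by rewrite /angle mulr0n mulr0 mul0r.
have cos0 (X : {set 'Z_p.+1}) : cos_sum X 0 = #|X|%:R.
  rewrite /cos_sum; under eq_bigr => x _ do rewrite angle0 (_ : cos 0 = 1 :> R) ?cos_0 //.
  by rewrite sumr_const.
have sin0 (X : {set 'Z_p.+1}) : sin_sum X 0 = 0.
  by rewrite /sin_sum big1 // => x _; rewrite angle0; apply: sin_0.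
rewrite !big_ord_recl !cos0 !sin0 /=.
set EA := \sum_(k < p) _; set ES := \sum_(k < p) _; set T := \sum_(k < p) _ => hA hS hT.
have TE : T <= K / 2 * (EA + ES).
  rewrite -big_split mulr_sumr; apply: ler_sum => k _.
  by apply: triple_term_le => //; apply: bound; rewrite /= ltnS ltn_ord.
have {}NS : #|A|%:R <= #|S|%:R :> R by rewrite ler_nat.
have {}pub : #|S|%:R + #|A|%:R <= p.+1%:R :> R by rewrite -natrD ler_nat.
have {}Sp : #|S|%:R < p.+1%:R :> R by rewrite ltr_nat.
move: (p.+1%:R : R) (#|A|%:R : R) (#|S|%:R : R) NS pub Sp hA hS hT => P N s NS pub Sp hA hS hT.
have Ps : 0 < P - s by rewrite subr_gt0.
rewrite -(ler_pM2r Ps).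
have h : K / 2 * (EA + ES) <= K / 2 * (2 * (s * (P - s))).
  rewrite ler_wpM2l ?divr_ge0 //; nra.
nra.
Qed.

(** * The constant alpha *)

(** The difference vanishes at 0 and has derivative mu (cos t - cos(mu t)), which is nonnegative
    since the cosine decreases on [0, PI]. *)
Lemma sinM_le (mu y : R) : 1 <= mu -> 0 <= y -> mu * y <= PI -> sin (mu * y) <= mu * sin y.
Proof.
move=> mu1 y0 muy; move: (y0); rewrite le0r => /orP[/eqP ->|y_gt0].
  by rewrite mulr0 (_ : sin 0 = 0 :> R) ?mulr0 //; apply: sin_0.
have [||c [fE cI]] := MVT_cor2 (fun t => mu * sin t - sin (mu * t))
    (fun t => mu * cos t - cos (mu * t) * (mu * 1)) 0 y.
- exact/RltP.
- move=> c _; apply: derivable_pt_lim_minus.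
    exact/derivable_pt_lim_scal/derivable_pt_lim_sin.
  apply: (derivable_pt_lim_comp (fun t => mu * t) sin).
    exact/derivable_pt_lim_scal/derivable_pt_lim_id.
  exact: derivable_pt_lim_sin.
case: cI => c0' /RltP cy; have c0 : 0 < c by apply/RltP.
rewrite -subr_ge0.
have E : mu * sin y - sin (mu * y) = (mu * cos c - cos (mu * c) * (mu * 1)) * y.
  move: fE; rewrite !RealsE !mulr0 (_ : sin 0 = 0 :> R); last exact: sin_0.
  by rewrite mulr0 !subr0.
rewrite E mulr1 [cos _ * mu]mulrC -mulrBr; apply: mulr_ge0 => //; apply: mulr_ge0; first lra.
rewrite subr_ge0; apply: cos_le_le; [exact: ltW|nra|].
by apply: le_trans muy; rewrite ler_pM2l ?ltW //; lra.
Qed.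

Arguments sinM_le mu%_ring_scope y%_ring_scope.

(** Five terms of the Leibniz series. The value 27/8 is (2a + 1)(a + 2) at a = 1/4, as [alpha_le]
    requires. *)
Lemma PI_le : PI <= 27 / 8 :> R.
Proof.
have [_] := PI_ineq 2; rewrite /sum_f_R0 /tg_alt /PI_tg /= => /RleP.
have e3 : 1 + 1 + 1 = 3 :> R by ring.
have e5 : 1 + 1 + 1 + 1 + 1 = 5 :> R by ring.
have e7 : 1 + 1 + 1 + 1 + 1 + 1 + 1 = 7 :> R by ring.
have e9 : 1 + 1 + 1 + 1 + 1 + 1 + 1 + 1 + 1 = 9 :> R by ring.
by rewrite !RealsE /= (_ : IZR (Zneg xH) = -1 :> R) // e9 e7 e5 e3; lra.
Qed.

Lemma sin_le_id (x : R) : 0 <= x -> sin x <= x.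
Proof.
rewrite le0r => /orP[/eqP ->|x0].
  by rewrite (_ : sin 0 = 0 :> R) //; apply: sin_0.
by apply/ltW/RltP/sin_lt_x/RltP.
Qed.

Lemma sinPI6 : sin (PI / 6) = 1 / 2.
Proof.
have := sin_PI6; rewrite !RealsE => E; rewrite -[RHS]E; congr sin.
Qed.

(* Since sin is concave, sin y >= (3 / PI) y on [0, PI / 6]. *)
Lemma sin_ge_chord (y : R) : 0 <= y <= PI / 6 -> 3 * y <= PI * sin y.
Proof.
case/andP=> y0 y6; have pi0 := PI_gt0.
move: (y0); rewrite le0r => /orP[/eqP ->|y_gt0].
  by rewrite (_ : sin 0 = 0 :> R) ?mulr0 //; apply: sin_0.
have := @sinM_le (PI / 6 / y) y; rewrite divfK ?gt_eqF // sinPI6.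
have -> : 1 <= PI / 6 / y by rewrite ler_pdivlMr // mul1r.
move=> /(_ isT y0 ltac:(lra)); rewrite mulrAC ler_pdivlMr //; lra.
Qed.

(** The closed form of [alpha] is the larger root of this quadratic; -5/4 is the midpoint of its two
    roots. *)
Lemma alpha_quadratic (eta : R) (p : nat) :
  0 < eta -> eta <= 1 -> (0 < p)%N ->
  (2 * alpha eta p + 1) * (alpha eta p + 2) * sin (PI * eta / 3) = eta * p%:R * sin (PI / p%:R)
  /\ - (5 / 4) <= alpha eta p.
Proof.
move=> eta0 eta1 p0; have pi0 := PI_gt0.
have p0R : 0 < p%:R :> R by rewrite ltr0n.
have s0 : 0 < sin (PI * eta / 3).
  have m0 : 0 < PI * eta by apply: mulr_gt0.
  have m1 : PI * eta <= PI by rewrite ger_pMr.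
  by apply: sin_gt0; apply/andP; split; lra.
have sp : 0 <= sin (PI / p%:R).
  apply: sin_ge0; apply/andP; split; first by rewrite divr_ge0 // ltW.
  have p1R : 1 <= p%:R :> R by rewrite ler1n.
  by rewrite ler_pdivrMr //; nra.
have [s sE] : exists s : R, s = 9 + 8 * (eta * p%:R * sin (PI / p%:R) / sin (PI * eta / 3)) by eexists.
have s_ge0 : 0 <= s.
  have n0 := mulr_ge0 (mulr_ge0 (ltW eta0) (ltW p0R)) sp.
  by have := divr_ge0 n0 (ltW s0); rewrite sE; lra.
have aE : alpha eta p = - (5 / 4) + 1 / 4 * Num.sqrt s.
  rewrite /alpha !RealsE /= sE; congr (_ + _ * Num.sqrt (_ + _)).
  by rewrite !mulrA.
have q_ge0 := sqrtr_ge0 s; have := sqr_sqrtr s_ge0.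
rewrite aE; move: (Num.sqrt s) q_ge0 => q q_ge0 q2; split; last lra.
have -> : (2 * (- (5 / 4) + 1 / 4 * q) + 1) * (- (5 / 4) + 1 / 4 * q + 2) = (q ^+ 2 - 9) / 8 by field.
by rewrite q2 sE; field; rewrite gt_eqF.
Qed.

(** For eta <= 1/2 the chord bound gives sin(pi eta/3) >= eta, and p sin(pi/p) <= pi, so (2 alpha +
    1)(alpha + 2) <= pi <= 27/8. *)
Lemma alpha_le (eta : R) (p : nat) :
  0 < eta -> eta <= 1 / 2 -> (0 < p)%N -> alpha eta p <= 1 / 4.
Proof.
move=> eta0 eta2 p0; have pi0 := PI_gt0.
have [] := @alpha_quadratic eta p eta0 ltac:(lra) p0.
move: (alpha eta p) => a E a54.
have p0R : 0 < p%:R :> R by rewrite ltr0n.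
have y0 : 0 < PI * eta by apply: mulr_gt0.
have s_ge : eta <= sin (PI * eta / 3).
  have [y yE] : exists y : R, y = PI * eta / 3 by eexists.
  have /sin_ge_chord : 0 <= y <= PI / 6 by rewrite yE; apply/andP; split; nra.
  rewrite -yE => h; rewrite -(ler_pM2l pi0); apply: le_trans h; rewrite yE; lra.
have psin : p%:R * sin (PI / p%:R) <= PI.
  by rewrite mulrC -ler_pdivlMr // sin_le_id // divr_ge0 ?ltW.
have := PI_le; rewrite leNgt => pi_le; apply/negP => a4.
have X_le : (2 * a + 1) * (a + 2) * eta <= PI * eta.
  apply: (@le_trans _ _ ((2 * a + 1) * (a + 2) * sin (PI * eta / 3))).
    by rewrite ler_pM2l // mulr_gt0 //; lra.
  by rewrite E -mulrA [leRHS]mulrC ler_pM2l.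
rewrite ler_pM2r // in X_le; nra.
Qed.

(** From sin(pi eta/3) <= pi eta/3 and, for p >= 6, p sin(pi/p) >= 3, a negative alpha would give 3
    < 2 pi/3, against pi <= 27/8. *)
Lemma alpha_ge0 (eta : R) (p : nat) :
  0 < eta -> eta <= 1 -> (6 <= p)%N -> 0 <= alpha eta p.
Proof.
move=> eta0 eta1 p6; have pi0 := PI_gt0; have p_gt0 : (0 < p)%N by apply: leq_trans p6.
have [] := @alpha_quadratic eta p eta0 eta1 p_gt0.
move: (alpha eta p) => a E a54.
have p0R : 0 < p%:R :> R by rewrite ltr0n.
have p6R : 6 <= p%:R :> R by rewrite ler_nat.
have s_le : sin (PI * eta / 3) <= PI * eta / 3.
  by apply: sin_le_id; have m0 := mulr_gt0 pi0 eta0; lra.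
have s0 : 0 < sin (PI * eta / 3).
  have m0 : 0 < PI * eta by apply: mulr_gt0.
  have m1 : PI * eta <= PI by rewrite ger_pMr.
  by apply: sin_gt0; apply/andP; split; lra.
have psin : 3 <= p%:R * sin (PI / p%:R).
  have [y yE] : exists y : R, y = PI / p%:R by eexists.
  have py : p%:R * y = PI by rewrite yE mulrC divfK // gt_eqF.
  have /sin_ge_chord : 0 <= y <= PI / 6.
    rewrite yE; apply/andP; split; first exact/ltW/divr_gt0.
    by rewrite ler_pM2l // lef_pV2 ?posrE.
  have y0 : 0 < y by rewrite yE divr_gt0.
  rewrite -yE => h; rewrite -(ler_pM2r y0); apply: le_trans h _.
  by rewrite -{1}py; lra.
have := PI_le => pi_le; rewrite leNgt; apply/negP => a0.
have X3 : 3 * eta <= (2 * a + 1) * (a + 2) * sin (PI * eta / 3).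
  by rewrite E [3 * _]mulrC -mulrA ler_pM2l.
have X2 : (2 * a + 1) * (a + 2) < 2 by nra.
have : (2 * a + 1) * (a + 2) * sin (PI * eta / 3) < 2 * (PI * eta / 3).
  apply: (@lt_le_trans _ _ (2 * sin (PI * eta / 3))); first by rewrite ltr_pM2r.
  by rewrite ler_pM2l.
have : PI * eta <= 27 / 8 * eta by rewrite ler_pM2r.
lra.
Qed.

(** * Dilations, rich half-circles and the conclusion *)

Lemma natr_Zp_neq0 (p k : nat) : prime p -> (0 < k < p)%N -> k%:R != 0 :> 'Z_p.
Proof.
move=> p_pr /andP[k0 kp]; rewrite -[k%:R]/(k%:Z%:~R) intr_Zp_eq0 // dvdzE /= gtnNdvd //.
Qed.

(** The coefficient of [A] at frequency k is that of the dilate k A at frequency 1, here projected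
    on the direction [th]. *)
Lemma dilate_cos_sum (p k : nat) (A : {set 'Z_p}) (th : R) :
  prime p -> (0 < k < p)%N ->
  cos_sum A k * cos th + sin_sum A k * sin th =
  \sum_(z in [set k%:R * x | x in A]) cos (2 * PI / p%:R * (nat_of_ord z)%:R - th).
Proof.
move=> p_pr kp; have p_neq0 : p%:R != 0 :> R by rewrite pnatr_eq0 -lt0n prime_gt0.
rewrite big_imset /=; last first.
  by move=> x y _ _; apply/mulrI/unit_Zp_prime => //; apply: natr_Zp_neq0.
rewrite mulrC [sin_sum _ _ * _]mulrC -sum_cosB; apply: eq_bigr => x _.
have [m mE] := @Zp_intr p (k%:R * x) (k%:Z * (nat_of_ord x)%:Z) p_pr ltac:(by rewrite rmorphM /= -!pmulrn natr_Zp).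
rewrite -cosN -[LHS](cosD2PI _ m); congr cos.
rewrite [X in _ = _ * X - _]pmulrn mE !(rmorphD, rmorphM) /= -!pmulrn /angle.
by field.
Qed.

Lemma coefficient_bound (p q D k : nat) (A : {set 'Z_p}) :
  prime p -> p = q.*2.+1 -> (1 < q)%N -> (0 < D)%N -> (D.*2 <= p)%N -> (0 < k < p)%N ->
  (forall j j' : 'Z_p, (window [set (k%:R * x)%R | x in A] q j +
     window [set (k%:R * x)%R | x in A] q j' <= #|A| + D)%N) ->
  cos_sum A k ^+ 2 + sin_sum A k ^+ 2 <= (sin (D%:R * (PI / p%:R)) / sin (PI / p%:R)) ^+ 2.
Proof.
move=> p_pr pE q1 D0 Dp kp win.
have [th [th0 <-]] := polar_angle (cos_sum A k) (sin_sum A k).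
have cB : #|[set (k%:R * x)%R | x in A]| = #|A|.
  by apply: card_imset; apply/mulrI/unit_Zp_prime => //; apply: natr_Zp_neq0.
rewrite (dilate_cos_sum _ _ p_pr kp) in th0 *.
have le_K := @Zp_cos_bound p q D [set k%:R * x | x in A] th p_pr pE q1 D0 Dp _.
by rewrite ler_sqr ?nnegrE //; [|apply: le_trans th0 _]; apply: le_K => j j'; rewrite cB.
Qed.

(** Undoing the dilation turns the half-circle from j into the progression from j/k with difference
    1/k. The part of [A] in it has indices in [0, q] with 2q < p, as [AP_structure] asks. *)
Lemma AP_of_window (p q k : nat) (j : 'Z_p) (A : {set 'Z_p}) :
  prime p -> p = q.*2.+1 -> (0 < k < p)%N -> (#|sumset A A| + #|A| <= p)%N ->
  (#|sumset A A| + 4 <= 3 * window [set (k%:R * x)%R | x in A] q j)%N ->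
  exists (h : 'Z_p) (PA P2A : {set 'Z_p}),
    is_AP h PA /\ is_AP h P2A /\ A \subset PA /\
    (#|PA|%:Z <= #|sumset A A|%:Z - #|A|%:Z + 1)%R /\
    P2A \subset sumset A A /\ (2 * #|A| - 1 <= #|P2A|)%N.
Proof.
move=> p_pr pE kp pub big; have kU : k%:R \is a @GRing.unit 'Z_p.
  by apply: unit_Zp_prime => //; apply: natr_Zp_neq0.
pose g : 'Z_p := k%:R^-1; pose b : 'Z_p := j / k%:R.
have g0 : g != 0 by rewrite invr_eq0; apply: natr_Zp_neq0.
pose X : {fset int} := [fset x in zitv 0 q.+1 | (b + g *~ x)%R \in A]%fset.
have XI (x : int) : x \in X -> 0 <= x <= 0 + q%:Z.
  by rewrite !inE mem_zitv => /andP[+ _]; lia.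
have XA : img b g X \subset A.
  by apply/subsetP => z /imgP[x]; rewrite !inE => /andP[_ xA] ->.
apply: (AP_structure p_pr g0 XI _ XA pub); first by lia.
apply: leq_trans big _; rewrite leq_mul2l /=.
pose f (t : 'I_q.+1) : 'Z_p := b + g *~ (nat_of_ord t)%:Z.
have f_inj : injective f.
  move=> t t' /(img_inj (a := 0) p_pr g0) E; apply/val_inj => /=.
  have := ltn_ord t; have := ltn_ord t' => tq tq'.
  by have := E ltac:(lia) ltac:(lia); case.
rewrite /window -(card_imset _ f_inj); apply/subset_leq_card/subsetP => _ /imsetP[t + ->].
rewrite inE => /imsetP[x xA E]; apply: mem_img; rewrite !inE mem_zitv.
have -> : b + g *~ (nat_of_ord t) = x.
  rewrite -pmulrn -[g *+ _]mulr_natl /b /g -mulrDl E mulrC mulKr //.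
by rewrite xA andbT; have := ltn_ord t; lia.
Qed.

(** With y = pi eta/3 and mu = (2a + 1) N/(eta p) >= 1, the angle pi D/p is at most mu y <= pi/2. So
    sin(pi D/p) <= mu sin y by concavity, and the quadratic for alpha makes (a + 2) mu sin y equal
    to N sin(pi/p). *)
Lemma sin_ratio_le (p N D : nat) (eta : R) :
  (5 < p)%N -> 0 < eta -> eta <= 1 / 2 -> eta * p%:R <= N%:R -> 2 * N%:R <= p%:R :> R ->
  D%:R <= (2 * alpha eta p + 1) * N%:R / 3 ->
  (alpha eta p + 2) * (sin (D%:R * (PI / p%:R)) / sin (PI / p%:R)) <= N%:R.
Proof.
move=> p6 eta0 eta2 etaN Np D_le; have pi0 := PI_gt0.
have p_gt0 : (0 < p)%N by apply: leq_trans p6.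
have p6R : 6 <= p%:R :> R by rewrite ler_nat.
have p0R : 0 < p%:R :> R by lra.
have [E _] := @alpha_quadratic eta p eta0 ltac:(lra) p_gt0.
have a4 := alpha_le eta0 eta2 p_gt0.
have a0 := @alpha_ge0 eta p eta0 ltac:(lra) p6.
move: (alpha eta p) E a4 a0 D_le => a E a4 a0 D_le.
have N0 : 0 < N%:R :> R by apply: lt_le_trans etaN; apply: mulr_gt0.
have [u uE] : exists u : R, u = PI / p%:R by eexists.
have pu : p%:R * u = PI by rewrite uE mulrC divfK // gt_eqF.
have u0 : 0 < u by rewrite uE divr_gt0.
have su : 0 < sin u by apply: sin_gt0; apply/andP; split => //; nra.
rewrite -uE in E *; rewrite mulrA ler_pdivrMr //.
have [mu muE] : exists mu : R, mu * (eta * p%:R) = (2 * a + 1) * N%:R.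
  exists ((2 * a + 1) * N%:R / (eta * p%:R)); rewrite divfK // gt_eqF // mulr_gt0 //.
have mu1 : 1 <= mu.
  have ep : 0 < eta * p%:R by apply: mulr_gt0.
  by rewrite -(ler_pM2r ep) muE mul1r; nra.
have [y yE] : exists y : R, y = PI * eta / 3 by eexists.
rewrite -yE in E.
have y0 : 0 <= y by rewrite yE; have := mulr_gt0 pi0 eta0; lra.
have muy : mu * y = (2 * a + 1) * N%:R / 3 * u.
  by rewrite yE -pu; have -> : mu * (p%:R * u * eta / 3) = mu * (eta * p%:R) * u / 3 by [field]; rewrite muE; field.
have muy_le : mu * y <= PI / 2.
  rewrite muy -pu; have : (2 * a + 1) * N%:R / 3 <= p%:R / 2 by nra.
  by rewrite -(ler_pM2r u0) => h; lra.
have sinD_le : sin (D%:R * u) <= mu * sin y.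
  apply: le_trans (sinM_le mu1 y0 ltac:(lra)).
  have Du : D%:R * u <= mu * y by rewrite muy ler_pM2r.
  have Du0 : 0 <= D%:R * u by rewrite mulr_ge0 // ltW.
  have cosE (t : R) : cos (PI / 2 - t) = sin t.
    by rewrite cosD cosN sinN cosPI2 (_ : sin (PI / 2) = 1 :> R); [ring|have := sin_PI2; rewrite !RealsE].
  rewrite -!cosE; apply: cos_le_le; lra.
apply: (@le_trans _ _ ((a + 2) * (mu * sin y))); first by rewrite ler_pM2l //; lra.
have ep : 0 < eta * p%:R by apply: mulr_gt0.
rewrite -(ler_pM2r ep).
have -> : (a + 2) * (mu * sin y) * (eta * p%:R) = (a + 2) * sin y * (mu * (eta * p%:R)) by ring.
rewrite muE; have -> : (a + 2) * sin y * ((2 * a + 1) * N%:R) = (2 * a + 1) * (a + 2) * sin y * N%:R by ring.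
rewrite E le_eqVlt; apply/orP; left; apply/eqP; ring.
Qed.

Lemma exists_large_window (p q : nat) (eta : R) (A : {set 'Z_p}) :
  prime p -> p = q.*2.+1 -> (5 < p)%N -> 0 < eta -> eta <= 1 / 2 -> eta * p%:R <= #|A|%:R ->
  (#|sumset A A| + #|A| <= p)%N -> (3 <= #|A|)%N ->
  #|sumset A A|%:R <= (2 + alpha eta p) * #|A|%:R - 3 ->
  exists (k : nat) (j : 'Z_p), (0 < k < p)%N /\
    (#|sumset A A| + 4 <= 3 * window [set (k%:R * x)%R | x in A] q j)%N.
Proof.
move=> p_pr pE p6 eta0 eta2 etaN pub N3 Sub.
have p_gt0 : (0 < p)%N by apply: leq_trans p6.
have NS := card_sumset_ge A.
have N2p : (2 * #|A| <= p)%N by clear -NS pub; lia.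
have Sp : (#|sumset A A| < p)%N by clear -N3 pub; lia.
have q1 : (1 < q)%N by clear -p6 pE; lia.
have a4 := alpha_le eta0 eta2 p_gt0.
have a0 := @alpha_ge0 eta p eta0 ltac:(lra) p6.
pose big (k : 'I_p) := (0 < k)%N &&
  [exists j, #|sumset A A| + 4 <= 3 * window [set ((k : nat)%:R * x)%R | x in A] q j]%N.
have [/existsP[k /andP[k0 /existsP[j kj]]]|] := boolP [exists k, big k].
  by exists k, j; rewrite k0 ltn_ord.
rewrite negb_exists => /forallP small; exfalso.
(* The largest window size possible when 3 times it stays below |2A| + 4. *)
pose w := ((#|sumset A A| + 3) %/ 3)%N.
have wle : (3 * w <= #|sumset A A| + 3)%N by rewrite mulnC leq_divM.
have le_w (x : nat) : (3 * x < #|sumset A A| + 4)%N -> (x <= w)%N.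
  by rewrite /w leq_divRL // mulnC; clear; lia.
(* 2w - |A| is the least excess that two windows allow. The floor 1, needed by the arc bound, still
   respects D <= (2 alpha + 1)|A|/3, since |A| >= 3 and alpha >= 0. *)
pose D := maxn 1 (2 * w - #|A|).
have Dw : (w + w <= #|A| + D)%N by rewrite /D; clear; lia.
have N3R : 3 <= #|A|%:R :> R by rewrite ler_nat.
have DR : D%:R <= (2 * alpha eta p + 1) * #|A|%:R / 3 :> R.
  rewrite /D /maxn; case: ifP => _; last by nra.
  have [wN|/ltnW Nw] := leqP (2 * w) #|A|.
    by have -> : (2 * w - #|A| = 0)%N by [apply/eqP; rewrite subn_eq0]; nra.
  rewrite natrB // natrM; have : 3 * w%:R <= #|sumset A A|%:R + 3 :> R.
    by rewrite -natrM -natrD ler_nat.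
  by move: Sub; lra.
have NpR : 2 * #|A|%:R <= p%:R :> R by rewrite -natrM ler_nat.
have Dp : (D.*2 <= p)%N.
  rewrite -(ler_nat R) -mul2n natrM; apply: le_trans NpR; rewrite ler_pM2l //; nra.
pose K := sin (D%:R * (PI / p%:R)) / sin (PI / p%:R).
have K_le := sin_ratio_le p6 eta0 eta2 etaN NpR DR; rewrite -/K in K_le.
have pi0 := PI_gt0.
have p6R : 6 <= p%:R :> R by rewrite ler_nat.
have pip : 0 < PI / p%:R by apply: divr_gt0 => //; lra.
have K0 : 0 <= K.
  apply: divr_ge0; apply: sin_ge0; apply/andP; split.
  - by apply: mulr_ge0 => //; apply: ltW.
  - rewrite mulrCA -[leRHS]mulr1 ler_pM2l // ler_pdivrMr ?mul1r; last by lra.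
    by rewrite ler_nat (leq_trans _ Dp) // -addnn leq_addr.
  - exact: ltW.
  - by rewrite ler_pdivrMr; [nra|lra].
have := @large_coefficient p A K p_pr K0 pub Sp.
have bound (k : nat) : (0 < k < p)%N -> cos_sum A k ^+ 2 + sin_sum A k ^+ 2 <= K ^+ 2.
  move=> kp; have /andP[k0 kp'] := kp; have := small (Ordinal kp'); rewrite /big /= k0 /=.
  rewrite negb_exists => /forallP win.
  apply: (coefficient_bound p_pr pE q1 _ Dp kp); first by rewrite /D leq_max.
  move=> j j'; apply: leq_trans (leq_add (le_w _ _) (le_w _ _)) Dw.
    by have := win j; rewrite -ltnNge.
  by have := win j'; rewrite -ltnNge.
move=> /(_ bound) NK.
have S0 : 0 <= #|sumset A A|%:R :> R by [].
move: (alpha eta p) a0 a4 Sub K_le {DR} => a a0 a4 Sub K_le.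
move: (#|A|%:R : R) (#|sumset A A|%:R : R) N3R Sub K_le NK S0 {etaN NpR} => N s N3R Sub K_le NK S0.
(* Together N^2 <= K s <= N^2 - 3K, impossible for K > 0; for K = 0 already N^2 <= 0 fails. *)
have h1 : K * s <= K * ((a + 2) * N - 3) by apply: ler_wpM2l => //; lra.
have h2 : K * (a + 2) * N <= N * N by rewrite ler_pM2r; [rewrite mulrC|lra].
have K1 : K = 0 \/ 0 < K by move: K0; rewrite le0r => /orP[/eqP|]; [left|right].
case: K1 => K1; first by move: NK; rewrite K1 mul0r expr2; nra.
by move: NK; rewrite expr2; nra.
Qed.

Theorem theorem1p4 (p : nat) (eta : R) (A : {set 'Z_p}) (r : int) :
  prime p ->
  Rlt 0 eta -> Rlt eta 1 ->
  Rle (Rmult eta (INR p)) (INR #|A|) -> Rlt 0 (Rmult eta (INR p)) ->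
  (#|sumset A A|%:Z = 2 * #|A|%:Z + r)%R ->
  (#|sumset A A| < p)%N ->
  Rle (INR #|sumset A A|) (Rminus (Rmult (Rplus 2 (alpha eta p)) (INR #|A|)) 3) ->
  (3 * #|A|%:Z <= p%:Z - r)%R ->
  exists (g : 'Z_p) (PA P2A : {set 'Z_p}),
    is_AP g PA /\ is_AP g P2A /\
    A \subset PA /\
    (#|PA|%:Z <= #|A|%:Z + r + 1)%R /\
    P2A \subset sumset A A /\
    (2 * #|A| - 1 <= #|P2A|)%N.
Proof.
have card_pub (s n : nat) : s%:Z = 2 * n%:Z + r -> 3 * n%:Z <= p%:Z - r -> (s + n <= p)%N by lia.
have card_PA (s n : nat) : s%:Z = 2 * n%:Z + r -> s%:Z - n%:Z + 1 <= n%:Z + r + 1 by lia.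
move=> p_pr /RltP; rewrite R0E => eta0 /RltP; rewrite R1E => eta1 /RleP; rewrite !INRE RmultE => etaN _.
move=> Sr Sp /RleP; rewrite !RealsE /= => Sub pr.
have pub : (#|sumset A A| + #|A| <= p)%N := card_pub _ _ Sr pr.
have NS := card_sumset_ge A; have p_gt0 := prime_gt0 p_pr.
have p0R : 0 < p%:R :> R by rewrite ltr0n.
have N2p : (2 * #|A| <= p)%N by rewrite mul2n -addnn (leq_trans _ pub) ?leq_add2r.
have NpR : 2 * #|A|%:R <= p%:R :> R by rewrite -natrM ler_nat.
have eta2 : eta <= 1 / 2 by rewrite -(ler_pM2r p0R); lra.
have a4 := alpha_le eta0 eta2 p_gt0.
have NSR : #|A|%:R <= #|sumset A A|%:R :> R by rewrite ler_nat.
(* From |A| <= |2A| <= (9/4)|A| - 3 one gets |A| >= 12/5. *)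
have N3 : (3 <= #|A|)%N.
  have arithR (a n s : R) : 0 <= n -> a <= 1 / 4 -> s <= (2 + a) * n - 3 -> n <= s -> 2 < n.
    by move=> n0 a_le s_le ns; nra.
  by have := arithR _ _ _ (ler0n _ _) a4 Sub NSR; rewrite ltr_nat.
have p5 : (5 < p)%N by apply: leq_trans N2p; exact: (@leq_mul 2 3 2 _ (leqnn 2) N3).
have [q pE] : exists q, p = q.*2.+1.
  exists p./2; rewrite -[LHS]odd_double_half; have [p2|->//] := even_prime p_pr.
  by rewrite p2 in p5.
have [k [j [kp big]]] := exists_large_window p_pr pE p5 eta0 eta2 etaN pub N3 Sub.
have [h [PA [P2A [hP [hP2 [sA [cA sS]]]]]]] := AP_of_window p_pr pE kp pub big.
exists h, PA, P2A; split=> //; split=> //; split=> //; split=> //.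
exact: le_trans cA (card_PA _ _ Sr).
Qed.
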